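(* Let $1<p,q<\infty$ with $\frac1p+\frac1q<1$, let $q'$ be given by $\frac1q+\frac1{q'}=1$, and let $\mu$ be a finite positive Borel measure on $[0,1)$. Then the operator $\mathcal I_\mu$ is well defined on $AT^q_p$ if and only if $$\sum_{n\ge0}\left[\mu\left(\left[1-\frac1{2^n},\,1-\frac1{2^{n+1}}\right)\right)2^{n\left(\frac1p+\frac1q\right)}\right]^{q'}<\infty.$$
   Context: $\mathbb D$ is the open unit disc of $\mathbb C$, $\mathbb T$ the unit circle, $dA$ the normalized area Lebesgue measure on $\mathbb D$, $|d\xi|$ arc length on $\mathbb T$. For $\xi\in\mathbb T$ put $$\Gamma_{1/2}(\xi)=\{z\in\mathbb D:|z|<1/2\}\cup\bigcup_{|z|<1/2}[z,\xi),$$ where $[z,\xi)$ is the half-open line segment from $z$ to $\xi$. For $1<p,q<\infty$, $AT^q_p$ is the space of analytic functions $f$ on $\mathbb D$ such that $$\|f\|_{AT^q_p}=\left\{\int_{\mathbb T}\left(\int_{\Gamma_{1/2}(\xi)}|f(z)|^p\,\frac{dA(z)}{1-|z|^2}\right)^{q/p}|d\xi|\right\}^{1/q}<\infty.$$ The integral operator is $$\mathcal I_\mu(f)(z)=\int_0^1\frac{f(t)}{1-tz}\,d\mu(t),\qquad z\in\mathbb D.$$ ''$\mathcal I_\mu$ is well defined on $AT^q_p$'' means that for every $f\in AT^q_p$ and every $z\in\mathbb D$ this (Lebesgue) integral converges, i.e. $\int_0^1\frac{|f(t)|}{|1-tz|}\,d\mu(t)<\infty$. *)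

(* Defs.v *)
From HB Require Import structures.
From mathcomp Require Import all_boot all_order all_algebra.
From mathcomp Require Import complex.
From mathcomp Require Import all_classical all_reals all_analysis.

Set Implicit Arguments.
Unset Strict Implicit.
Unset Printing Implicit Defensive.

Import Order.TTheory GRing.Theory Num.Theory.
Import numFieldNormedType.Exports.

Local Open Scope classical_set_scope.
Local Open Scope ring_scope.
Local Open Scope complex_scope.

(* The R-valued modulus; [`|z|] lives in [R[i]]. *)
Notation normc := ComplexField.Normc.normc.

Definition unit_disc (R : realType) : set R[i] := [set z | normc z < 1].

(* Locally the sum of a convergent power series at each point of U.  The radius
   may be shrunk at will, so values of f outside an open U are irrelevant. *)
Definition analytic_on (R : realType) (U : set R[i]) (f : R[i] -> R[i]) : Prop :=
  forall z0, U z0 ->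
    exists (a : nat -> R[i]) (r : R), 0 < r /\
      forall z, normc (z - z0) < r ->
        series (fun k => a k * (z - z0) ^+ k : R[i]^o) @ \oo --> (f z : R[i]^o).

(* The half-open segment [z, w). *)
Definition segment_co (R : realType) (z w : R[i]) : set R[i] :=
  [set (1 - t)%:C * z + t%:C * w | t in `[0 : R, 1[].

Definition Gamma_half (R : realType) (xi : R[i]) : set R[i] :=
  [set z | unit_disc z /\ normc z < 2^-1] `|`
  \bigcup_(z in [set z | normc z < 2^-1]) segment_co z xi.

(* Integral over E against area measure, normalized so that the unit disc, of
   area pi, has mass 1. *)
Definition area_integral (R : realType) (E : set R[i]) (g : R[i] -> \bar R) :
    \bar R :=
  ((pi^-1)%:E *
   \int[@lebesgue_measure R \x @lebesgue_measure R]_(w in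
        [set w : R * R | E (w.1 +i* w.2)]) g (w.1 +i* w.2))%E.

(* Integral over the unit circle against (unnormalized) arc length. *)
Definition circle_integral (R : realType) (g : R[i] -> \bar R) : \bar R :=
  (\int[@lebesgue_measure R]_(theta in `[0%R, (2 * pi)%R])
      g (cos theta +i* sin theta))%E.

Definition AT_norm (R : realType) (p q : R) (f : R[i] -> R[i]) : \bar R :=
  (circle_integral (fun xi : R[i] =>
     area_integral (Gamma_half xi)
       (fun z => (normc (f z) `^ p / (1 - normc z ^+ 2))%:E) `^ (q / p))
   `^ (q^-1))%E.

Definition AT_space (R : realType) (p q : R) (f : R[i] -> R[i]) : Prop :=
  analytic_on (@unit_disc R) f /\ (AT_norm p q f < +oo)%E.

(* For every f in AT^q_p and every z in the disc, the Lebesgue integral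
   I_mu(f)(z) of f(t) / (1 - t z) over [0, 1) against mu converges. *)
Definition I_well_defined (R : realType) (p q : R)
    (mu : {finite_measure set (measurableTypeR R) -> \bar R}) : Prop :=
  forall f : R[i] -> R[i], AT_space p q f ->
  forall z : R[i], unit_disc z ->
    (\int[mu]_(t in `[0%R, 1%R[)
        (normc (f t%:C) / normc (1 - t%:C * z))%:E < +oo)%E.

Definition dyadic_interval (R : realType) (n : nat) : set R :=
  `[1 - 1 / 2 ^+ n, 1 - 1 / 2 ^+ n.+1[.

(* Main.v *)
Require Import Defs.
From HB Require Import structures.
From mathcomp Require Import all_boot all_order all_algebra.
From mathcomp Require Import complex.
From mathcomp Require Import all_classical all_reals all_analysis.
From mathcomp Require Import measurable_realfun ring lra zify.

(* Taking [z = 0] and using [1 - |z| <= |1 - t z|], the operator is well defined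
   iff every [f] in the space is mu-integrable on [0, 1).  Put
   [s = 1/p + 1/q], [I_n] the n-th dyadic interval, [b_n = mu(I_n) 2^(n s)].

   Sufficiency.  For [t] in [I_n] and [theta] comparable to [1 - t], the disc of
   centre [t] and radius [(1 - t) / 4] lies in the cone at [e^(i theta)], so
   the sub-mean-value property bounds [|f t| ^ p] by [2 ^ n] times the cone
   integral at [e^(i theta)].  Integrating over disjoint dyadic arcs shows that
   [|f t| <= 2 ^ (n s) x_n] on [I_n] for some sequence [x] in l^q, and
   Young's inequality bounds [\sum_n b_n x_n].

   Necessity.  Every [c] in l^q is dominated by a sequence in l^q varying slowly
   in [n]; with [w_n] that sequence times [2 ^ (n s)], the function
   [\sum_n w_n 2^-n / (1 - (1 - 2^-n) z)] lies in the space and is at least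
   [w_n / 2] on [I_n].  Hence [\sum_n b_n c_n] converges for every
   [c] in l^q, and Landau's theorem puts [b] in l^q'. *)

Set Implicit Arguments.
Unset Strict Implicit.
Unset Printing Implicit Defensive.

Import Order.TTheory GRing.Theory Num.Theory.
Import numFieldNormedType.Exports.

Local Open Scope classical_set_scope.
Local Open Scope ring_scope.

(** * Integrals of nonnegative functions that need not be measurable *)

Section nonneg_integral.
Local Open Scope ereal_scope.
Context d (T : measurableType d) (R : realType) (mu : {measure set T -> \bar R}).

(** Analyticity is given as a local power series, so the mean value property is reached by real
    calculus: the difference quotient of [f] has a continuous derivative, and suitable partial
    derivatives integrate to zero over a disc by Fubini. The cone integral is not known to be
    measurable in [theta]; upper bounds therefore come from countable covers by measurable sets,
    lower bounds from disjoint measurable sets carrying constants. In the necessity part the kernel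
    has order one. At distance about 2^-k from 1, its terms with n <= k contribute at most about
    w_n, those with n >= k at most about w_n 2^-(n-k). The first group is controlled by w_k if w
    grows geometrically, the second if w grows more slowly than 2^n. The rate 2^(n s) does both
    because 0 < s < 1, which is where 1/p + 1/q < 1 enters. An arbitrary l^q factor could spoil both
    comparisons, hence the smoothing of c. *)

Lemma ge0_subset_le_integral (D E : set T) (f g : T -> \bar R) :
  D `<=` E -> (forall x, E x -> 0 <= g x) -> (forall x, D x -> 0 <= f x <= g x) ->
  \int[mu]_(x in D) f x <= \int[mu]_(x in E) g x.
Proof.
move=> DE g0 fg.
(* Both integrals become suprema over the nonnegative simple functions below the integrand, and such
   suprema are monotone for arbitrary integrands. *)
rewrite !ge0_integralE//; last by move=> x /fg/andP[].
apply: le_ereal_sup => _ [h /= hf <-]; exists h => // x.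
apply: (le_trans (hf x)); rewrite !patchE.
case: ifPn => [|_].
  by rewrite inE => Dx; rewrite mem_set; [case/andP: (fg _ Dx)|exact: DE].
by case: ifPn => // /[!inE]; exact: g0.
Qed.

Lemma integral_series_cst_indic (v : nat -> \bar R) (A : nat -> set T) :
  (forall n, 0 <= v n) -> (forall n, measurable (A n)) ->
  \int[mu]_x (\sum_(n <oo) v n * (\1_(A n) x)%:E) = \sum_(n <oo) v n * mu (A n).
Proof.
move=> v0 mA; have mi n : measurable_fun setT (fun x : T => (\1_(A n) x : R)%:E).
  exact/measurable_EFinP/measurable_indic.
have i0 n x : 0 <= (\1_(A n) x : R)%:E by rewrite lee_fin.
rewrite integral_nneseries//.
- apply: eq_eseriesr => n _; rewrite ge0_integralZl//.
  by rewrite integral_indic// setIT.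
- by move=> n; apply: emeasurable_funM.
- by move=> n x _; rewrite mule_ge0.
Qed.

(** The sets [A n] may overlap: the sum of all [v n] times indicators dominates [g] as soon as one
    of its terms does. *)
Lemma integral_le_series (D : set T) (g : T -> \bar R)
    (v : nat -> \bar R) (A : nat -> set T) :
  (forall n, 0 <= v n) -> (forall n, measurable (A n)) ->
  (forall x, D x -> 0 <= g x) ->
  (forall x, D x -> exists2 n, A n x & g x <= v n) ->
  \int[mu]_(x in D) g x <= \sum_(n <oo) v n * mu (A n).
Proof.
move=> v0 mA g0 gv; rewrite -integral_series_cst_indic//.
have s0 x : 0 <= \sum_(n <oo) v n * (\1_(A n) x)%:E.
  by apply: nneseries_ge0 => n _ _; rewrite mule_ge0// lee_fin.
apply: ge0_subset_le_integral => // x Dx; rewrite g0//=.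
have [n Anx /le_trans] := gv _ Dx; apply.
apply: le_trans (nneseries_lim_ge n.+1 _); last first.
  by move=> k _; rewrite mule_ge0// lee_fin.
rewrite big_nat_recr//= indicE mem_set//= mule1 leeDr//.
by apply: sume_ge0 => i _; rewrite mule_ge0// lee_fin.
Qed.

Lemma series_le_integral (D : set T) (g : T -> \bar R)
    (v : nat -> \bar R) (A : nat -> set T) :
  (forall n, 0 <= v n) -> (forall n, measurable (A n)) ->
  (forall n, A n `<=` D) -> trivIset setT A ->
  (forall x, D x -> 0 <= g x) -> (forall n x, A n x -> v n <= g x) ->
  \sum_(n <oo) v n * mu (A n) <= \int[mu]_(x in D) g x.
Proof.
move=> v0 mA AD tA g0 vg; rewrite -integral_series_cst_indic//.
rewrite (integral_mkcond D).
have s0 x : 0 <= \sum_(n <oo) v n * (\1_(A n) x)%:E.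
  by apply: nneseries_ge0 => n _ _; rewrite mule_ge0// lee_fin.
apply: ge0_subset_le_integral => // x _; first exact: erestrict_ge0.
rewrite s0/=.
have [[n Anx]|nA] := pselect (exists n, A n x); last first.
  rewrite eseries0; first exact: erestrict_ge0.
  move=> n _ _; rewrite indicE memNset ?mule0// => Anx.
  by apply: nA; exists n.
rewrite (@nneseriesD1 _ _ n)//; last by move=> k _; rewrite mule_ge0// lee_fin.
rewrite eseries0 ?adde0; last first.
  move=> k _ kn; rewrite indicE memNset ?mule0// => Akx.
  move/negP: kn; apply; apply/eqP/(tA k n) => //; by exists x.
rewrite indicE mem_set//= mule1 patchE mem_set; first exact: vg Anx.
exact: AD Anx.
Qed.

End nonneg_integral.

Local Open Scope complex_scope.

Local Notation Re := complex.Re.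
Local Notation Im := complex.Im.

(** * The real-valued modulus on the complex numbers *)

Section normc_theory.
Variable R : realType.
Implicit Types (x y z w : R[i]).

Lemma normcE z : `|z| = (normc z)%:C.
Proof. by rewrite normc_def; case: z. Qed.

Lemma normc_ge0 z : 0 <= normc z.
Proof. by case: z => a b; exact: sqrtr_ge0. Qed.

Lemma normc_eq0 z : (normc z == 0) = (z == 0).
Proof. by rewrite -[RHS]normr_eq0 normcE -(inj_eq (@complexI R)). Qed.

Lemma normc_gt0 z : (0 < normc z) = (z != 0).
Proof. by rewrite lt_neqAle normc_ge0 andbT eq_sym normc_eq0. Qed.

Lemma normcM z w : normc (z * w) = normc z * normc w.
Proof. exact: ComplexField.Normc.normcM. Qed.

Lemma normcV z : normc z^-1 = (normc z)^-1.
Proof. exact: ComplexField.Normc.normcV. Qed.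

Lemma normcX z n : normc (z ^+ n) = normc z ^+ n.
Proof.
elim: n => [|n ih]; first by rewrite !expr0 ComplexField.Normc.normc1.
by rewrite !exprS normcM ih.
Qed.

Lemma normc_distC z w : normc (z - w) = normc (w - z).
Proof. by rewrite -normcN opprB. Qed.

Lemma normcB_le z w : normc (z - w) <= normc z + normc w.
Proof. by rewrite -(normcN w); exact: le_normcD. Qed.

Lemma normc_dist_le y z w : normc (z - w) <= normc (z - y) + normc (y - w).
Proof. by rewrite -(subrKA y); exact: le_normcD. Qed.

Lemma normc_sum_le (I : Type) (r : seq I) (F : I -> R[i]) :
  normc (\sum_(i <- r) F i) <= \sum_(i <- r) normc (F i).
Proof.
elim/big_ind2 : _ => // [|u a v b ua vb]; first by rewrite ComplexField.Normc.normc0.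
by rewrite (le_trans (le_normcD _ _))// lerD.
Qed.

Lemma normc_real (a : R) : normc a%:C = `|a|.
Proof. by rewrite /= expr0n/= addr0 sqrtr_sqr. Qed.

Lemma normc_Re_le z : `|Re z| <= normc z.
Proof. by rewrite -lecR -normcE; exact: normc_ge_Re. Qed.

Lemma normc_Im_le z : `|Im z| <= normc z.
Proof.
case: z => a b /=; rewrite -sqrtr_sqr ler_sqrt ?lerDr ?sqr_ge0//.
by rewrite addr_ge0 ?sqr_ge0.
Qed.

Lemma normc_le_ReIm z : normc z <= `|Re z| + `|Im z|.
Proof.
rewrite [X in normc X]complexE (le_trans (le_normcD _ _))//.
by rewrite normcM !normc_real/= expr0n expr1n add0r sqrtr1 mul1r.
Qed.

Lemma sqr_normcE z : normc z ^+ 2 = Re z ^+ 2 + Im z ^+ 2.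
Proof. by case: z => a b /=; rewrite sqr_sqrtr// addr_ge0 ?sqr_ge0. Qed.

Lemma cvg_normcP (u : nat -> R[i]) (l : R[i]) :
  (u : nat -> R[i]^o) @ \oo --> (l : R[i]^o) <->
  forall e : R, 0 < e -> exists N, forall n, (N <= n)%N -> normc (l - u n) < e.
Proof.
split=> [/cvgrPdist_lt ul e e0|H].
  have [] := ul e%:C; first by rewrite ltcR.
  by move=> N _ NH; exists N => n /NH/=; rewrite normcE ltcR.
apply/cvgrPdist_lt => -[e ei]; rewrite ltcE/= => /andP[/eqP ei0 e0].
have [N NH] := H e e0; exists N => // n /NH /=.
by rewrite normcE ei0 ltcR.
Qed.

End normc_theory.

(** * Power series and complex derivatives *)

Section complex_derivative.
Variable R : realType.
Implicit Types f g d : R[i] -> R[i].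

(** The two-point estimate, with both points moving near [z0], is what later forces the derivative
    to be Lipschitz at [z0]. *)
Definition strict_deriv f z0 (D : R[i]) := exists C e : R, [/\ 0 <= C, 0 < e &
  forall u v, normc (u - z0) < e -> normc (v - z0) < e ->
  normc (f u - f v - D * (u - v)) <=
    C * (normc (u - z0) + normc (v - z0)) * normc (u - v)].

(** The one-point version survives division by [z - c] and restricts to horizontal and vertical
    lines, where it yields partial derivatives. *)
Definition quad_deriv f z0 (D : R[i]) := exists C e : R, [/\ 0 <= C, 0 < e &
  forall u, normc (u - z0) < e ->
  normc (f u - f z0 - D * (u - z0)) <= C * normc (u - z0) ^+ 2].

Definition lipschitz_at f z0 := exists C e : R, [/\ 0 <= C, 0 < e &
  forall u, normc (u - z0) < e -> normc (f u - f z0) <= C * normc (u - z0)].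

Lemma strict_quad_deriv f z0 D : strict_deriv f z0 D -> quad_deriv f z0 D.
Proof.
move=> [C [e [C0 e0 H]]]; exists C, e; split => // u ue.
have := H u z0 ue; rewrite subrr ComplexField.Normc.normc0 addr0 => /(_ e0).
by rewrite expr2 mulrA.
Qed.

Lemma quad_deriv_lipschitz f z0 D : quad_deriv f z0 D -> lipschitz_at f z0.
Proof.
move=> [C [e [C0 e0 H]]]; exists (C * e + normc D), e; split => //.
  by rewrite addr_ge0 ?mulr_ge0 ?normc_ge0// ltW.
move=> u ue; have := H u ue => Hu.
have -> : f u - f z0 = (f u - f z0 - D * (u - z0)) + D * (u - z0) by ring.
rewrite (le_trans (le_normcD _ _))// normcM mulrDl lerD2r (le_trans Hu)//.
by rewrite expr2 mulrA ler_wpM2r ?normc_ge0// ler_wpM2l// ltW.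
Qed.

Lemma pseries_coef_bound (a : nat -> R[i]) (w l : R[i]) :
  series (fun k => a k * w ^+ k : R[i]^o) @ \oo --> (l : R[i]^o) ->
  exists2 M, 0 <= M & forall k, normc (a k) * normc w ^+ k <= M.
Proof.
move=> /cvg_normcP/(_ 1 ltr01)[N HN].
exists (2 + \sum_(k < N) normc (a k) * normc w ^+ k).
  by rewrite addr_ge0// sumr_ge0// => k _; rewrite mulr_ge0 ?exprn_ge0 ?normc_ge0.
have s0 (I : finType) (P : pred I) (F : I -> nat) :
    0 <= \sum_(k | P k) normc (a (F k)) * normc w ^+ (F k).
  by apply: sumr_ge0 => k _; rewrite mulr_ge0 ?exprn_ge0 ?normc_ge0.
move=> k; have [kN|Nk] := ltnP k N.
  by rewrite (bigD1 (Ordinal kN))//= addrCA lerDl addr_ge0.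
apply: (@le_trans _ _ 2); last by rewrite lerDl.
rewrite -normcX -normcM.
set S := series (fun k => a k * w ^+ k : R[i]^o) in HN.
have -> : a k * w ^+ k = (l - S k) - (l - S k.+1).
  by rewrite /S seriesS; ring.
rewrite (le_trans (normcB_le _ _))// -[2]/(1 + 1) ltW// ltrD// HN//.
by rewrite (leq_trans Nk).
Qed.

Lemma normc_subXX_le (u v : R[i]) (m : R) n : normc u <= m -> normc v <= m ->
  normc (u ^+ n.+1 - v ^+ n.+1) <= normc (u - v) * (n.+1%:R * m ^+ n).
Proof.
move=> um vm; rewrite subrXX normcM ler_wpM2l ?normc_ge0//.
rewrite (le_trans (normc_sum_le _ _))//.
rewrite mulr_natl -[X in _ *+ X](card_ord n.+1) -sumr_const ler_sum// => i _.
have m0 : 0 <= m by exact: le_trans (normc_ge0 u) um.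
have -> : m ^+ n = m ^+ (n.+1.-1 - i) * m ^+ i.
  by rewrite -exprD subnK// -ltnS.
rewrite normcM !normcX.
by apply: ler_pM; rewrite ?exprn_ge0 ?normc_ge0// lerXn2r ?nnegrE ?normc_ge0.
Qed.

(** The terms of degree at least two of the series for [f u - f v] factor through [u - v] and are
    dominated geometrically by the coefficient bound at radius [rho]. *)
Lemma pseries_strict_deriv f z0 (a : nat -> R[i]) (r : R) : 0 < r ->
  (forall z, normc (z - z0) < r ->
    series (fun k => a k * (z - z0) ^+ k : R[i]^o) @ \oo --> (f z : R[i]^o)) ->
  strict_deriv f z0 (a 1%N).
Proof.
move=> r0 Hf; have [rho rhoE] : exists rho, rho = r / 2 by exists (r / 2).
have rho0 : 0 < rho by rewrite rhoE divr_gt0.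
have [|M M0 HM] := @pseries_coef_bound a rho%:C (f (z0 + rho%:C)).
  have -> : rho%:C = (z0 + rho%:C) - z0 by ring.
  have -> : z0 + (z0 + rho%:C - z0) = z0 + rho%:C by ring.
  apply: Hf; have -> : (z0 + rho%:C) - z0 = rho%:C by ring.
  by rewrite normc_real gtr0_norm// rhoE; lra.
rewrite normc_real gtr0_norm// in HM.
have [B BE] : exists B, B = M * 4 / rho ^+ 2 by exists (M * 4 / rho ^+ 2).
have B0 : 0 <= B by rewrite BE divr_ge0 ?sqr_ge0// mulr_ge0.
(* Radius [rho / 8] makes [2 * m / rho] at most 1/2, where the 2 absorbs the degree through n <=
   2^n; the geometric series of ratio 1/2 then gives the factor 2 on [B]. *)
exists (B * 2), (rho / 8); split; [by rewrite pmulr_lge0|by rewrite divr_gt0|].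
move=> u v; set U := u - z0; set V := v - z0 => Ue Ve.
pose m := normc U + normc V.
have m0 : 0 <= m by rewrite addr_ge0 ?normc_ge0.
have Um : normc U <= m by rewrite lerDl normc_ge0.
have Vm : normc V <= m by rewrite lerDr normc_ge0.
have mrho : 2 * m / rho <= 2^-1 by rewrite ler_pdivrMr// /m; lra.
have uvE : u - v = U - V by rewrite /U /V; ring.
have term k : normc (a k.+2 * (U ^+ k.+2 - V ^+ k.+2)) <=
    normc (u - v) * (m * B) * 2^-1 ^+ k.
  rewrite normcM uvE.
  have H1 := @normc_subXX_le U V m k.+1 Um Vm.
  apply: (le_trans (ler_wpM2l (normc_ge0 _) H1)).
  rewrite mulrCA -!mulrA ler_wpM2l ?normc_ge0//.
  have k2 : (k.+2%:R : R) <= 2 ^+ k.+2 by rewrite -natrX ler_nat ltnW// ltn_expl.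
  apply: (@le_trans _ _ (normc (a k.+2) * (2 ^+ k.+2 * m ^+ k.+1))).
    by rewrite ler_wpM2l ?normc_ge0// ler_wpM2r// exprn_ge0.
  have -> : normc (a k.+2) * (2 ^+ k.+2 * m ^+ k.+1) =
      normc (a k.+2) * rho ^+ k.+2 * (m * (4 / rho ^+ 2 * (2 * m / rho) ^+ k)).
    rewrite !exprMn exprVn !exprS; field.
    by rewrite ?expf_neq0 ?gt_eqF.
  have -> : m * (B * 2^-1 ^+ k) = M * (m * (4 / rho ^+ 2 * 2^-1 ^+ k)).
    by rewrite BE; ring.
  have q0 : 0 <= 4 / rho ^+ 2 by rewrite divr_ge0 ?sqr_ge0.
  have mr0 : 0 <= 2 * m / rho by rewrite divr_ge0 ?mulr_ge0 ?(ltW rho0).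
  apply: ler_pM => //; first by rewrite mulr_ge0 ?exprn_ge0 ?normc_ge0 ?(ltW rho0).
    by rewrite mulr_ge0// mulr_ge0// exprn_ge0.
  by rewrite ler_wpM2l// ler_wpM2l// lerXn2r ?nnegrE// invr_ge0.
pose S w := series (fun k => a k * w ^+ k : R[i]^o).
have SS w n : S w n.+1 = a n * w ^+ n + S w n by rewrite /S seriesS.
have S0 w : S w 0%N = 0 by rewrite /S /series/= big_geq.
have part n : normc (S U n.+2 - S V n.+2 - a 1%N * (u - v)) <=
    normc (u - v) * (m * B) * (2 - 2 * 2^-1 ^+ n).
  elim: n => [|n ih].
    rewrite !SS !S0 !expr0 !expr1 !addr0 !mulr1.
    have -> : a 1%N * U + a 0%N - (a 1%N * V + a 0%N) - a 1%N * (u - v) = 0.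
      by rewrite uvE; ring.
    by rewrite ComplexField.Normc.normc0 subrr mulr0.
  rewrite (SS U) (SS V).
  have -> : a n.+2 * U ^+ n.+2 + S U n.+2 - (a n.+2 * V ^+ n.+2 + S V n.+2) -
      a 1%N * (u - v) = (S U n.+2 - S V n.+2 - a 1%N * (u - v)) +
      a n.+2 * (U ^+ n.+2 - V ^+ n.+2) by ring.
  rewrite (le_trans (le_normcD _ _))// (le_trans (lerD ih (term n)))//.
  rewrite -mulrDr ler_wpM2l ?mulr_ge0 ?normc_ge0// exprS; lra.
apply/ler_addgt0Pr => e e0.
have e20 : 0 < e / 2 by rewrite divr_gt0.
have rr8 : rho / 8 < r by rewrite rhoE; lra.
have /cvg_normcP/(_ _ e20)[N1 HN1] := Hf u (lt_trans Ue rr8).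
have /cvg_normcP/(_ _ e20)[N2 HN2] := Hf v (lt_trans Ve rr8).
pose n := maxn N1 N2.
have {}HN1 : normc (f u - S U n.+2) < e / 2 := HN1 n.+2 (leq_trans (leq_maxl N1 N2) (leqW (leqnSn _))).
have {}HN2 : normc (f v - S V n.+2) < e / 2 := HN2 n.+2 (leq_trans (leq_maxr N1 N2) (leqW (leqnSn _))).
have -> : f u - f v - a 1%N * (u - v) = (S U n.+2 - S V n.+2 - a 1%N * (u - v))
    + ((f u - S U n.+2) - (f v - S V n.+2)) by ring.
rewrite (le_trans (le_normcD _ _))// lerD//.
  rewrite (le_trans (part n))// -/m.
  have -> : B * 2 * m * normc (u - v) = normc (u - v) * (m * B) * 2 by ring.
  rewrite ler_wpM2l ?mulr_ge0 ?normc_ge0// gerBl mulr_ge0// exprn_ge0// invr_ge0//.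
by rewrite (splitr e); exact: (le_trans (normcB_le _ _) (ltW (ltrD HN1 HN2))).
Qed.

(** For [w] close to [z], [(d z - d z0) * (w - z)] is the difference of two remainders, one measured
    from [z0] and one from [z]. Divide by [w - z] and let [w] tend to [z]. *)
Lemma strict_deriv_lipschitz f d z0 : strict_deriv f z0 (d z0) ->
  (exists2 e : R, 0 < e & forall z, normc (z - z0) < e -> quad_deriv f z (d z)) ->
  lipschitz_at d z0.
Proof.
move=> [C [e [C0 e0 H]]] [e' e'0 H'].
exists (C * 2), (Num.min e e'); split; rewrite ?lt_min ?e0 ?mulr_ge0//.
move=> z; rewrite lt_min => /andP[ze ze'].
have [C1 [e1 [C10 e10 H1]]] := H' z ze'.
apply/ler_addgt0Pr => eps eps0.
(* [C1] and [e1] depend on [z] without uniformity, so the step [t] is chosen last; its contribution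
   [(C + C1) * t] is absorbed in [eps]. *)
pose t := Num.min (Num.min (e1 / 2) ((e - normc (z - z0)) / 2)) (eps / (C + C1 + 1)).
have CC1 : 0 < C + C1 + 1 by lra.
have t0 : 0 < t.
  by rewrite !lt_min !divr_gt0// subr_gt0.
have te1 : t < e1.
  by rewrite (@le_lt_trans _ _ (e1 / 2))// ?/t ?ge_min ?lexx//; lra.
have te : t < e - normc (z - z0).
  rewrite (@le_lt_trans _ _ ((e - normc (z - z0)) / 2))//; last by lra.
  by rewrite /t !ge_min lexx orbT.
have teps : (C + C1) * t <= eps.
  have : t <= eps / (C + C1 + 1) by rewrite /t ge_min lexx orbT.
  rewrite ler_pdivlMr//; nra.
pose w := z + t%:C.
have wz : w - z = t%:C by rewrite /w; ring.
have nwz : normc (w - z) = t by rewrite wz normc_real gtr0_norm.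
have wz0 : normc (w - z0) <= t + normc (z - z0).
  by rewrite -nwz; exact: normc_dist_le.
have Hw := H w z (le_lt_trans wz0 _) ze.
have {}Hw : normc (f w - f z - d z0 * (w - z)) <=
    C * (normc (w - z0) + normc (z - z0)) * normc (w - z).
  by apply: Hw; lra.
have := H1 w; rewrite nwz => /(_ te1) H1w.
rewrite -(@ler_pM2r _ t)// -{1}nwz -normcM.
have -> : (d z - d z0) * (w - z) = (f w - f z - d z0 * (w - z)) -
  (f w - f z - d z * (w - z)) by ring.
rewrite (le_trans (normcB_le _ _))// (le_trans (lerD Hw H1w))// nwz expr2 mulrA.
rewrite -mulrDl ler_wpM2r ?(ltW t0)//; nra.
Qed.

End complex_derivative.

(** * Difference quotients of analytic functions *)

Section difference_quotient.
Variable R : realType.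
Implicit Types f g d : R[i] -> R[i].

Lemma unit_disc_ball (z : R[i]) : unit_disc z ->
  forall w, normc (w - z) < 1 - normc z -> unit_disc w.
Proof.
move=> z1 w wz; rewrite /unit_disc/=.
have := le_normcD (w - z) z; rewrite subrK; lra.
Qed.

(** The quotient is the shifted power series, which dictates the value [a 1] at the removable
    singularity and gives differentiability there. *)
Lemma pseries_quotient f (c : R[i]) (a : nat -> R[i]) (r : R) : 0 < r ->
  (forall z, normc (z - c) < r ->
    series (fun k => a k * (z - c) ^+ k : R[i]^o) @ \oo --> (f z : R[i]^o)) ->
  forall z, normc (z - c) < r ->
    series (fun k => a k.+1 * (z - c) ^+ k : R[i]^o) @ \oo -->
    ((if z == c then a 1%N else (f z - f c) / (z - c)) : R[i]^o).
Proof.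
move=> r0 Hf z zr; apply/cvg_normcP => e e0.
have SE w n : series (fun k => a k * w ^+ k : R[i]^o) n.+1 =
    a 0%N + w * series (fun k => a k.+1 * w ^+ k : R[i]^o) n.
  rewrite /series/= big_nat_recl// expr0 mulr1; congr (_ + _).
  by rewrite mulr_sumr; apply: eq_bigr => k _; rewrite exprS mulrCA.
have a0 : a 0%N = f c.
  apply/eqP; rewrite -subr_eq0 -normc_eq0 eq_le normc_ge0 andbT.
  apply/ler_addgt0Pr => e' e'0; rewrite add0r.
  have := Hf c; rewrite subrr ComplexField.Normc.normc0 => /(_ r0).
  move=> /cvg_normcP/(_ _ e'0)[N /(_ N.+1 (leqnSn _))].
  by rewrite SE mul0r addr0 normc_distC => /ltW.
have [->|zc] := eqVneq z c.
  exists 1%N => -[//|n] _; rewrite subrr /series/= big_nat_recl//.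
  rewrite big1 => [|i _]; last by rewrite exprS mul0r mulr0.
  by rewrite expr0 mulr1 addr0 subrr ComplexField.Normc.normc0.
have zc0 : z - c != 0 by rewrite subr_eq0.
have nzc : 0 < normc (z - c) by rewrite normc_gt0.
have /cvg_normcP := Hf z zr; move=> /(_ _ (mulr_gt0 e0 nzc))[N HN].
exists N => n Nn; have := HN n.+1 (leqW Nn).
rewrite SE a0 => H; rewrite -(@ltr_pM2r _ (normc (z - c)))// -normcM.
set Q := (X in normc X); suff -> : Q = f z - (f c + (z - c) * series (fun k => a k.+1 * (z - c) ^+ k : R[i]^o) n) by [].
by rewrite /Q; move: (series _ _) => s; field.
Qed.

(** Multiplied by [w - c], the remainder of [g] becomes the remainder of [f] minus
    [G * (w - z) ^+ 2]. Staying within half the distance from [z] to [c] bounds [w - c] from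
    below. *)
Lemma quotient_quad_deriv f g (c z : R[i]) (e : R) (D : R[i]) :
  z != c -> 0 < e -> (forall w, normc (w - z) < e -> f w - f c = (w - c) * g w) ->
  quad_deriv f z D -> quad_deriv g z ((D - g z) / (z - c)).
Proof.
move=> zc e0 Hg [C [e1 [C0 e10 H]]].
have zc0 : z - c != 0 by rewrite subr_eq0.
have nzc : 0 < normc (z - c) by rewrite normc_gt0.
pose G := (D - g z) / (z - c).
exists ((C + normc G) * 2 / normc (z - c)), (Num.min (Num.min e e1) (normc (z - c) / 2)).
split; rewrite ?lt_min ?e0 ?e10 ?divr_gt0 ?divr_ge0 ?mulr_ge0 ?addr_ge0 ?normc_ge0//.
move=> w; rewrite !lt_min => /andP[/andP[we we1] wzc].
have wc : normc (z - c) / 2 <= normc (w - c).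
  have := normc_dist_le w z c; rewrite (normc_distC z w); lra.
have wc0 : 0 < normc (w - c) by rewrite (lt_le_trans _ wc)// divr_gt0.
rewrite -(@ler_pM2l _ (normc (w - c)))// -normcM -/G.
have zz : normc (z - z) < e by rewrite subrr ComplexField.Normc.normc0.
have -> : (w - c) * (g w - g z - G * (w - z)) =
    (f w - f z - D * (w - z)) - G * (w - z) ^+ 2.
  have GE : G * (z - c) = D - g z by rewrite divfK.
  have -> : D = G * (z - c) + g z by rewrite GE subrK.
  have -> : f w - f z = (w - c) * g w - (z - c) * g z.
    by rewrite -Hg// -Hg//; ring.
  ring.
rewrite (le_trans (normcB_le _ _))// normcM normcX.
apply: (@le_trans _ _ ((C + normc G) * normc (w - z) ^+ 2)).
  by rewrite mulrDl lerD2r H.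
have -> : normc (w - c) * ((C + normc G) * 2 / normc (z - c) * normc (w - z) ^+ 2) =
  ((C + normc G) * normc (w - z) ^+ 2) * (normc (w - c) * 2 / normc (z - c)).
  by ring.
rewrite ler_peMr ?mulr_ge0 ?exprn_ge0 ?addr_ge0 ?normc_ge0//.
by rewrite ler_pdivlMr// mul1r -ler_pdivrMr.
Qed.

Lemma quotient_lipschitz d g (c z0 : R[i]) :
  z0 != c -> lipschitz_at d z0 -> lipschitz_at g z0 ->
  lipschitz_at (fun z => (d z - g z) / (z - c)) z0.
Proof.
move=> zc [C1 [e1 [C10 e10 H1]]] [C2 [e2 [C20 e20 H2]]].
have zc0 : z0 - c != 0 by rewrite subr_eq0.
have nzc : 0 < normc (z0 - c) by rewrite normc_gt0.
pose G := (d z0 - g z0) / (z0 - c).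
exists ((C1 + C2 + normc G) * 2 / normc (z0 - c)),
  (Num.min (Num.min e1 e2) (normc (z0 - c) / 2)).
split; rewrite ?lt_min ?e10 ?e20 ?divr_gt0 ?divr_ge0 ?mulr_ge0 ?addr_ge0 ?normc_ge0//.
move=> w; rewrite !lt_min => /andP[/andP[we1 we2] wzc].
have wc : normc (z0 - c) / 2 <= normc (w - c).
  have := normc_dist_le w z0 c; rewrite (normc_distC z0 w); lra.
have wc0 : 0 < normc (w - c) by rewrite (lt_le_trans _ wc)// divr_gt0.
rewrite -(@ler_pM2l _ (normc (w - c)))// -normcM -/G.
have wcn0 : w - c != 0 by rewrite -normc_gt0.
have -> : (w - c) * ((d w - g w) / (w - c) - G) =
    (d w - d z0) - (g w - g z0) - G * (w - z0).
  have GE : G * (z0 - c) = d z0 - g z0 by rewrite divfK.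
  rewrite mulrBr mulrC divfK// -[w - c](subrKA z0) mulrDl [(z0 - c) * G]mulrC GE.
  ring.
rewrite (le_trans (normcB_le _ _))// (le_trans (lerD (normcB_le _ _) (lexx _)))//.
rewrite normcM.
apply: (@le_trans _ _ ((C1 + C2 + normc G) * normc (w - z0))).
  by rewrite !mulrDl lerD// lerD ?H1 ?H2.
have -> : normc (w - c) * ((C1 + C2 + normc G) * 2 / normc (z0 - c) * normc (w - z0)) =
  ((C1 + C2 + normc G) * normc (w - z0)) * (normc (w - c) * 2 / normc (z0 - c)).
  by ring.
rewrite ler_peMr ?mulr_ge0 ?addr_ge0 ?normc_ge0//.
by rewrite ler_pdivlMr// mul1r -ler_pdivrMr.
Qed.

Lemma analytic_strict_deriv f (z : R[i]) :
  analytic_on (@unit_disc R) f -> unit_disc z -> exists D, strict_deriv f z D.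
Proof.
by move=> af /af[a [r [r0 H]]]; exists (a 1%N); exact: pseries_strict_deriv r0 H.
Qed.

(** The Lipschitz bound makes [d], the derivative of [g], continuous, as integration over discs and
    the fundamental theorem on slices require. At [c] it comes from the power series shifted once
    more, elsewhere from the quotient rule. *)
Lemma analytic_quotient f (c : R[i]) :
  analytic_on (@unit_disc R) f -> unit_disc c ->
  exists g d, forall z, unit_disc z ->
    [/\ f z - f c = (z - c) * g z, quad_deriv g z (d z) & lipschitz_at d z].
Proof.
move=> af c1.
have /boolp.choice[df Hdf] : forall z, exists D, unit_disc z -> strict_deriv f z D.
  move=> z; have [z1|z1] := pselect (unit_disc z).
    by have [D] := analytic_strict_deriv af z1; exists D.
  by exists 0.
have Hlip z : unit_disc z -> lipschitz_at df z.
  move=> z1; apply: strict_deriv_lipschitz (Hdf z z1) _.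
  exists (1 - normc z); rewrite ?subr_gt0// => w /(unit_disc_ball z1) w1.
  exact/strict_quad_deriv/Hdf.
have [a [r [r0 Ha]]] := af c c1.
pose g z := if z == c then a 1%N else (f z - f c) / (z - c).
have Hg := pseries_quotient r0 Ha.
have gc : strict_deriv g c (a 2%N).
  exact: (@pseries_strict_deriv _ g c (fun k => a k.+1) r).
pose d z := if z == c then a 2%N else (df z - g z) / (z - c).
have fg z : f z - f c = (z - c) * g z.
  rewrite /g; have [->|zc] := eqVneq z c; first by rewrite !subrr mul0r.
  by rewrite mulrC divfK// subr_eq0.
have gd z : unit_disc z -> quad_deriv g z (d z).
  move=> z1; rewrite /d; have [->|zc] := eqVneq z c; first exact: strict_quad_deriv.
  by apply: (@quotient_quad_deriv f g c z 1) => //; exact/strict_quad_deriv/Hdf.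
exists g, d => z z1; split => //; first exact: gd.
have [->|zc] := eqVneq z c.
  apply: (@strict_deriv_lipschitz _ g); first by rewrite /d eqxx.
  exists (1 - normc c); rewrite ?subr_gt0// => w /(unit_disc_ball c1) w1.
  exact: gd.
have [C [e [C0 e0 H]]] := quotient_lipschitz zc (Hlip z z1) (quad_deriv_lipschitz (gd z z1)).
(* The radius excludes [c], where [d] is defined by the other branch. *)
exists C, (Num.min e (normc (z - c))); split => //.
  by rewrite lt_min e0 normc_gt0 subr_eq0.
move=> w; rewrite lt_min => /andP[we wzc]; have := H w we.
rewrite /d (negbTE zc); case: eqVneq => // wc.
by move: wzc; rewrite wc normc_distC ltxx.
Qed.

End difference_quotient.

Local Arguments ComplexField.Normc.normc : simpl never.

(** * The mean value property *)

Section plane_measurability.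
Variable R : realType.

(** Measurability refers to the product sigma-algebra, so the open set is written as the countable
    union of the rational rectangles that it contains. *)
Lemma open_prod_measurable (A : set (R * R)) : open A ->
  measurable (A : set (measurableTypeR R * measurableTypeR R)).
Proof.
move=> oA.
pose rect (q : rat * rat * (rat * rat)) : set (R * R) :=
  `]ratr q.1.1, ratr q.1.2[%classic `*` `]ratr q.2.1, ratr q.2.2[%classic.
pose F q := if `[< rect q `<=` A >] then rect q else set0.
have -> : A = \bigcup_q F q.
  apply/seteqP; split => [[x y] Axy|w [q _]]; last first.
    by rewrite /F; case: ifPn => // /asboolP; exact.
  have := oA; rewrite openE => /(_ _ Axy)[[/= Q1 Q2] [Hx Hy] HA].
  move/nbhs_ballP: Hx => [e1 /= e10 He1]; move/nbhs_ballP: Hy => [e2 /= e20 He2].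
  have [a] := @rat_in_itvoo R (x - e1) x ltac:(lra).
  have [b] := @rat_in_itvoo R x (x + e1) ltac:(lra).
  have [c] := @rat_in_itvoo R (y - e2) y ltac:(lra).
  have [d] := @rat_in_itvoo R y (y + e2) ltac:(lra).
  rewrite !in_itv/= => /andP[yd dy] /andP[yc cy] /andP[xb bx] /andP[xa ax].
  exists ((a, b), (c, d)) => //; rewrite /F asboolT.
    by rewrite /rect; split; rewrite /= in_itv/= ?xb ?ax ?yd ?cy.
  move=> [u v]; rewrite /rect/= => -[]; rewrite /= !in_itv/=.
  move=> /andP[au ub] /andP[cv vd]; apply: HA; split => /=.
    apply: He1; rewrite /ball/= ltr_norml; apply/andP; split; lra.
  apply: He2; rewrite /ball/= ltr_norml; apply/andP; split; lra.
apply: countable_bigcupT_measurable => [|q]; first exact: countableP.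
rewrite /F; case: ifPn => // _; apply: measurableX; exact: measurable_itv.
Qed.

Lemma continuous_prod_measurable_fun (D : set (R * R)) (h : R * R -> R) :
  open D -> (forall w, D w -> {for w, continuous h}) ->
  measurable_fun (D : set (measurableTypeR R * measurableTypeR R)) h.
Proof.
move=> oD ch; apply: (measurability _ (RGenOpens.measurableE R)).
move=> _ [_ [a [b ->]] <-]; apply: open_prod_measurable.
rewrite openE => w [Dw hw]; apply: filterI; first exact: open_nbhs_nbhs.
by apply: (ch _ Dw); apply: open_nbhs_nbhs; split => //; exact: interval_open.
Qed.

Lemma near_normc (x y e : R) : 0 < e ->
  \forall w \near (x, y), normc ((w.1 +i* w.2) - (x +i* y)) < e.
Proof.
move=> e0; have e20 : 0 < e / 2 by rewrite divr_gt0.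
exists (ball x (e / 2), ball y (e / 2)) => /=.
  by split; exact: nbhsx_ballx.
move=> [u v] [/= bu bv]; rewrite (le_lt_trans (normc_le_ReIm _))//= (splitr e).
by rewrite ltrD// distrC.
Qed.

Lemma lipschitz_continuous (F : R[i] -> R[i]) (ph : R[i] -> R) (x y : R) :
  (forall z w, `|ph z - ph w| <= normc (z - w)) ->
  lipschitz_at F (x +i* y) ->
  {for (x, y), continuous (fun w : R * R => ph (F (w.1 +i* w.2)))}.
Proof.
move=> Hph [C [e [C0 e0 H]]]; apply/cvgrPdist_lt => eps eps0.
have C1 : 0 < C + 1 by lra.
have := near_normc x y e0.
have := near_normc x y (divr_gt0 eps0 C1); apply: filterS2 => w H1 H2 /=.
rewrite distrC (le_lt_trans (Hph _ _))// (le_lt_trans (H _ H2))//.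
have := normc_ge0 ((w.1 +i* w.2) - (x +i* y)).
by move: H1; rewrite ltr_pdivlMr//; nra.
Qed.

Lemma Re_lipschitz (z w : R[i]) : `|Re z - Re w| <= normc (z - w).
Proof. by have := normc_Re_le (z - w); case: z; case: w. Qed.

Lemma Im_lipschitz (z w : R[i]) : `|Im z - Im w| <= normc (z - w).
Proof. by have := normc_Im_le (z - w); case: z; case: w. Qed.

Lemma normc_lipschitz (z w : R[i]) : `|normc z - normc w| <= normc (z - w).
Proof.
have := le_normcD (z - w) w; have := le_normcD (w - z) z.
rewrite !subrK normc_distC ler_norml => H1 H2; apply/andP; split; lra.
Qed.

End plane_measurability.

Section slices.
Variable R : realType.

Lemma quad_is_derive (ph : R -> R) (x l C e : R) : 0 <= C -> 0 < e ->
  (forall u, `|u - x| < e -> `|ph u - ph x - l * (u - x)| <= C * (u - x) ^+ 2) ->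
  is_derive x 1 ph l.
Proof.
move=> C0 e0 H.
have cv : (fun h : R => h^-1 *: ((ph \o shift x) (h *: (1 : R)) - ph x)) @ 0^' --> l.
  apply/cvgrPdist_lt => eps eps0.
  have C1 : 0 < C + 1 by lra.
  have d0 : 0 < Num.min e (eps / (C + 1)) by rewrite lt_min e0 divr_gt0.
  exists (Num.min e (eps / (C + 1))) => //= h; rewrite /ball/= sub0r normrN.
  rewrite lt_min => /andP[he hC] h0.
  have := H (h + x); rewrite addrK => /(_ he) Hh.
  rewrite /= /shift/= /GRing.scale/= mulr1.
  rewrite -(@ltr_pM2r _ `|h|) ?normr_gt0// -normrM.
  have -> : (l - h^-1 * (ph (h + x) - ph x)) * h = - (ph (h + x) - ph x - l * h).
    by field.
  rewrite normrN (le_lt_trans Hh)// -[h ^+ 2]real_normK ?num_real//.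
  have : 0 < `|h| by rewrite normr_gt0.
  move: hC; rewrite ltr_pdivlMr//; move: `|h| => t; nra.
by apply: DeriveDef; [apply/cvg_ex; exists l|exact/cvg_lim].
Qed.

(** A chord of a disc is [[a - s, a + s]] with [s ^+ 2 = s2], and [ph] vanishes at its ends. Fubini
    runs over all lines, so [s2] may also be negative (no chord) or zero (a tangent). *)
Lemma slice_integral0 (ph dph : R -> R) (a s2 : R) :
  (forall x, (x - a) ^+ 2 <= s2 -> is_derive x 1 ph (dph x)) ->
  (forall x, (x - a) ^+ 2 <= s2 -> {for x, continuous dph}) ->
  (forall x, (x - a) ^+ 2 = s2 -> ph x = 0) ->
  (\int[@lebesgue_measure R]_(x in [set x : R | ((x - a) ^+ 2 <= s2)%R]) (dph x)%:E = 0)%E.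
Proof.
move=> Hd Hc H0; have [s20|s20|s20] := ltgtP s2 0.
- rewrite (_ : [set x | _] = set0) ?integral_set0// -subset0 => x /=.
  by move=> /le_lt_trans/(_ s20); rewrite ltNge sqr_ge0.
- pose s := Num.sqrt s2.
  have s0 : 0 < s by rewrite sqrtr_gt0.
  have ss : s ^+ 2 = s2 by rewrite sqr_sqrtr// ltW.
  have E x : ((x - a) ^+ 2 <= s2) = (a - s <= x <= a + s).
    rewrite -ss -ler_distl -(@ler_pXn2r _ 2%N _ `|x - a|)// ?nnegrE ?(ltW s0)//.
    by rewrite real_normK ?num_real.
  rewrite (_ : [set x | _] = `[a - s, a + s]%classic); last first.
    by apply/seteqP; split => x /=; rewrite in_itv/= E.
  rewrite (@continuous_FTC2 _ dph ph); first 1 last.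
  - lra.
  - apply: continuous_in_subspaceT => x; rewrite inE/= in_itv/= -E; exact: Hc.
  - have Hcont x : a - s <= x <= a + s -> {for x, continuous ph}.
      move=> xas; have := Hd x; rewrite E => /(_ xas) [dx _].
      exact/differentiable_continuous/derivable1_diffP.
    split.
    + move=> x; rewrite in_itv/= => /andP[/ltW x1 /ltW x2].
      by have := Hd x; rewrite E x1 x2 => /(_ isT) [].
    + apply: cvg_at_right_filter; apply: Hcont; lra.
    + apply: cvg_at_left_filter; apply: Hcont; lra.
  - move=> x; rewrite in_itv/= => /andP[/ltW x1 /ltW x2].
    have := Hd x; rewrite E x1 x2 => /(_ isT) dx.
    by rewrite derive1E; exact: derive_val.
  rewrite !H0 ?subee//; rewrite -ss; ring.
- rewrite (_ : [set x | _] = [set a]) ?integral_set1//.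
  apply/seteqP; split => x /=; last by move=> ->; rewrite s20 subrr expr0n.
  rewrite s20 => x0; apply/eqP; rewrite -subr_eq0 -sqrf_eq0 eq_le x0.
  exact: sqr_ge0.
Qed.

End slices.

(** * Integration over closed discs of the plane *)

Section mean_value.
Variable R : realType.

Definition plane_disc (a b r : R) : set (R * R) :=
  [set w | (w.1 - a) ^+ 2 + (w.2 - b) ^+ 2 <= r ^+ 2].

Local Notation leb := (@lebesgue_measure R).

Lemma measurable_plane_disc (a b r : R) :
  measurable (plane_disc a b r : set (measurableTypeR R * measurableTypeR R)).
Proof.
pose h (w : measurableTypeR R * measurableTypeR R) : R :=
  (w.1 - a) ^+ 2 + (w.2 - b) ^+ 2.
have mh : measurable_fun setT h.
  by apply: measurable_funD; apply: measurable_funX; apply: measurable_funB.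
have := mh measurableT `]-oo, r ^+ 2]%classic (measurable_itv _).
by rewrite setTI (_ : _ @^-1` _ = plane_disc a b r)//;
  apply/seteqP; split => w; rewrite /= in_itv.
Qed.

Lemma plane_disc_square (a b r : R) : 0 < r ->
  plane_disc a b r `<=` `[a - r, a + r] `*` `[b - r, b + r].
Proof.
move=> r0 [x y]; rewrite /plane_disc/= => H.
have sq (u : R) : u ^+ 2 <= r ^+ 2 -> `|u| <= r.
  move=> ur; rewrite -(@ler_pXn2r _ 2%N _ `|u|) ?nnegrE ?(ltW r0)//.
  by rewrite real_normK ?num_real.
rewrite /= !in_itv/= -!ler_distl; split; apply: sq; apply: le_trans H.
  by rewrite lerDl sqr_ge0.
by rewrite lerDr sqr_ge0.
Qed.

Lemma lebesgue_square (a b r : R) : 0 <= r ->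
  (leb \x leb)%E (`[a - r, a + r] `*` `[b - r, b + r]) = (4 * r ^+ 2)%:E.
Proof.
move=> r0; rewrite product_measure1E//.
have E c : leb `[c - r, c + r]%classic = (2 * r)%:E.
  rewrite lebesgue_measure_itv/= lte_fin.
  case: ifPn => [_|]; first by rewrite -EFinB; congr (_%:E); ring.
  by rewrite -leNgt => H; congr (_%:E); lra.
transitivity ((2 * r)%:E * (2 * r)%:E)%E; first by congr (_ * _)%E; exact: E.
by rewrite -EFinM; congr (_%:E); ring.
Qed.

(** Inscribed and circumscribed squares replace the exact area, since only the order of magnitude
    matters. *)
Lemma plane_disc_measure_bounds (a b r : R) : 0 < r ->
  ((r ^+ 2)%:E <= (leb \x leb) (plane_disc a b r) <= (4 * r ^+ 2)%:E)%E.
Proof.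
move=> r0; apply/andP; split.
  have -> : (r ^+ 2)%:E = (4 * (r / 2) ^+ 2)%:E :> \bar R.
    by congr (_%:E); field.
  rewrite -(@lebesgue_square a b) ?divr_ge0 ?(ltW r0)//.
  apply: le_measure; rewrite ?inE.
  - by apply: measurableX; exact: measurable_itv.
  - exact: measurable_plane_disc.
  - move=> [x y] [/= ]; rewrite !in_itv/= /plane_disc/= -!ler_distl => H1 H2.
    rewrite -[(x - a) ^+ 2]real_normK ?num_real// -[(y - b) ^+ 2]real_normK ?num_real//.
    have := normr_ge0 (x - a); have := normr_ge0 (y - b).
    by move: `|x - a| `|y - b| H1 H2 => u v; nra.
rewrite -(@lebesgue_square a b) ?(ltW r0)//.
apply: le_measure; rewrite ?inE.
- exact: measurable_plane_disc.
- by apply: measurableX; exact: measurable_itv.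
- exact: plane_disc_square.
Qed.

Section on_disc.
Variables (a b r : R).
Hypothesis r0 : 0 < r.
Hypothesis sub_disc : forall w : R[i], normc (w - (a +i* b)) <= 2 * r -> unit_disc w.

Let U : set (R * R) := [set w | unit_disc (w.1 +i* w.2)].

Let B := plane_disc a b r.

(** This is the reason for the radius [2 * r] in [sub_disc]: the circumscribed square, compact and a
    product of intervals, must lie in the unit disc too, so that continuous functions are bounded on
    it. *)
Lemma square_unit_disc (x y : R) : `|x - a| <= r -> `|y - b| <= r ->
  unit_disc (x +i* y).
Proof.
move=> xa yb; apply: sub_disc; rewrite (le_trans (normc_le_ReIm _))//=.
by rewrite mulr2n mulrDl !mul1r lerD.
Qed.

Lemma plane_disc_unit_disc (w : R * R) : B w -> unit_disc (w.1 +i* w.2).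
Proof.
by move/(plane_disc_square r0) => []; rewrite /= !in_itv/= -!ler_distl;
  exact: square_unit_disc.
Qed.

Lemma plane_disc_integrable (P : R * R -> R) :
  (forall w, U w -> {for w, continuous P}) ->
  (leb \x leb)%E.-integrable B (EFin \o P).
Proof.
move=> cP; apply: measurable_bounded_integrable.
- exact: measurable_plane_disc.
- have /andP[_] := plane_disc_measure_bounds a b r0.
  by move=> /le_lt_trans; apply; exact: ltry.
- apply: (@measurable_funS _ _ _ _ U).
  + apply: open_prod_measurable.
    rewrite openE => -[x y] Uxy; have := near_normc x y; rewrite /U/=.
    move=> /(_ (1 - normc (x +i* y))); rewrite subr_gt0 => /(_ Uxy).
    by apply: filterS => w; exact: unit_disc_ball.
  + by move=> w /plane_disc_unit_disc.
  + apply: continuous_prod_measurable_fun => //.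
    rewrite openE => -[x y] Uxy; have := near_normc x y; rewrite /U/=.
    move=> /(_ (1 - normc (x +i* y))); rewrite subr_gt0 => /(_ Uxy).
    by apply: filterS => w; exact: unit_disc_ball.
- pose K : set (R * R) := `[a - r, a + r] `*` `[b - r, b + r].
  have cK : compact K by apply: compact_setX; exact: segment_compact.
  have : compact (P @` K).
    apply: continuous_compact cK; apply: continuous_in_subspaceT => w.
    rewrite inE => -[]; rewrite /= !in_itv/= -!ler_distl => H1 H2.
    by apply: cP; exact: square_unit_disc.
  move/compact_bounded => [M [Mr HM]]; exists M; split => // x Mx w Bw.
  by apply: HM => //; exists w => //; exact: plane_disc_square.
Qed.

Lemma plane_disc_integral_slices (P : R * R -> R) :
  (forall w, U w -> {for w, continuous P}) ->
  (forall y, (\int[leb]_(x in [set x : R | ((x - a) ^+ 2 <= r ^+ 2 - (y - b) ^+ 2)%R])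
      (P (x, y))%:E = 0)%E) \/
  (forall x, (\int[leb]_(y in [set y : R | ((y - b) ^+ 2 <= r ^+ 2 - (x - a) ^+ 2)%R])
      (P (x, y))%:E = 0)%E) ->
  (\int[leb \x leb]_(w in B) (P w)%:E = 0)%E.
Proof.
move=> cP H.
have iP : (leb \x leb)%E.-integrable setT ((EFin \o P) \_ B).
  apply/integrable_restrict => //; first exact: measurable_plane_disc.
  by rewrite setTI; exact: plane_disc_integrable.
rewrite integral_mkcond.
case: H => H.
  rewrite -(integral21_prod_meas1 iP) integral0_eq// => y _.
  rewrite /fubini_G -[RHS](H y) [RHS]integral_mkcond; apply: eq_integral => x _.
  rewrite !patchE (_ : (x \in _) = ((x, y) \in B))//.
  by apply/idP/idP; rewrite !inE /B /plane_disc/= lerBrDr.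
rewrite -(integral12_prod_meas1 iP) integral0_eq// => x _.
rewrite /fubini_F -[RHS](H x) [RHS]integral_mkcond; apply: eq_integral => y _.
rewrite !patchE (_ : (y \in _) = ((x, y) \in B))//.
by apply/idP/idP; rewrite !inE /B /plane_disc/= lerBrDl.
Qed.

End on_disc.
End mean_value.

Section analytic_mean_value.
Variable R : realType.
Local Notation leb := (@lebesgue_measure R).

Lemma quad_deriv_partial_Re (g : R[i] -> R[i]) (x y : R) (D : R[i]) :
  quad_deriv g (x +i* y) D -> is_derive x 1 (fun u => Re (g (u +i* y))) (Re D).
Proof.
move=> [C [e [C0 e0 H]]]; apply: (@quad_is_derive R _ x _ C e) => // u ue.
have E : (u +i* y) - (x +i* y) = (u - x)%:C.
  by apply/eqP; rewrite eq_complex/= subrr !eqxx.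
have := H (u +i* y); rewrite E normc_real => /(_ ue).
rewrite real_normK ?num_real//; apply: le_trans.
rewrite (le_trans _ (normc_Re_le _))// le_eqVlt; apply/orP; left; apply/eqP.
clear H; congr `|_|; case: (g (u +i* y)) (g (x +i* y)) D => [p1 p2] [q1 q2] [d1 d2] /=.
ring.
Qed.

Lemma quad_deriv_partial_Im (g : R[i] -> R[i]) (x y : R) (D : R[i]) :
  quad_deriv g (x +i* y) D -> is_derive y 1 (fun u => Im (g (x +i* u))) (Re D).
Proof.
move=> [C [e [C0 e0 H]]]; apply: (@quad_is_derive R _ y _ C e) => // u ue.
have E : (x +i* u) - (x +i* y) = 0 +i* (u - y).
  by apply/eqP; rewrite eq_complex/= subrr !eqxx.
have nE : normc ((x +i* u) - (x +i* y)) = `|u - y|.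
  by rewrite E /ComplexField.Normc.normc expr0n add0r sqrtr_sqr.
have := H (x +i* u); rewrite nE => /(_ ue).
rewrite real_normK ?num_real//; apply: le_trans.
rewrite (le_trans _ (normc_Im_le _))// le_eqVlt; apply/orP; left; apply/eqP.
rewrite E; clear H; congr `|_|.
case: (g (x +i* u)) (g (x +i* y)) D => [p1 p2] [q1 q2] [d1 d2] /=; ring.
Qed.

Section on_disc.
Variables (f : R[i] -> R[i]) (a b r : R).
Hypothesis af : analytic_on (@unit_disc R) f.
Hypothesis r0 : 0 < r.
Hypothesis sub_disc : forall w : R[i], normc (w - (a +i* b)) <= 2 * r -> unit_disc w.

(* With [g = (f - f c) / (z - c)] and [h = (r^2 - |z - c|^2) g], the
   Cauchy-Riemann operator sends [h] to [- (f - f c)] up to a factor, and [h]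
   vanishes on the circle, so both partial derivatives integrate to [0] slice
   by slice. *)
Lemma mean_value_Re :
  (\int[leb \x leb]_(w in plane_disc a b r)
     (Re (f (w.1 +i* w.2)) - Re (f (a +i* b)))%:E = 0)%E.
Proof.
have c1 : unit_disc (a +i* b).
  by apply: sub_disc; rewrite subrr ComplexField.Normc.normc0 mulr_ge0// ltW.
have [g [d gd]] := analytic_quotient af c1.
pose rho (w : R * R) := r ^+ 2 - (w.1 - a) ^+ 2 - (w.2 - b) ^+ 2.
pose Reg (w : R * R) := Re (g (w.1 +i* w.2)).
pose Img (w : R * R) := Im (g (w.1 +i* w.2)).
pose Red (w : R * R) := Re (d (w.1 +i* w.2)).
pose Px w := - 2 * (w.1 - a) * Reg w + rho w * Red w.
pose Py w := - 2 * (w.2 - b) * Img w + rho w * Red w.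
have cfst (w : R * R) : {for w, continuous (@fst R R)} by exact: cvg_fst.
have csnd (w : R * R) : {for w, continuous (@snd R R)} by exact: cvg_snd.
have crho (w : R * R) : {for w, continuous rho}.
  by apply: continuousB; [apply: continuousB|];
    rewrite /continuous_at; [exact: cvg_cst|..];
    rewrite /= ?expr2; apply: cvgM; apply: cvgB; (exact: cfst || exact: csnd || exact: cvg_cst).
have cg w : unit_disc (w.1 +i* w.2) ->
    [/\ {for w, continuous Reg}, {for w, continuous Img} & {for w, continuous Red}].
  case: w => x y /= /gd[_ /quad_deriv_lipschitz lg ld]; split.
  - exact: (lipschitz_continuous (@Re_lipschitz R) lg).
  - exact: (lipschitz_continuous (@Im_lipschitz R) lg).
  - exact: (lipschitz_continuous (@Re_lipschitz R) ld).
have cPx w : unit_disc (w.1 +i* w.2) -> {for w, continuous Px}.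
  move=> /cg[c1' c2 c3]; apply: cvgD; apply: cvgM => //; last exact: crho.
  apply: cvgM; first exact: cvg_cst.
  apply: cvgB; [exact: cfst|exact: cvg_cst].
have cPy w : unit_disc (w.1 +i* w.2) -> {for w, continuous Py}.
  move=> /cg[c1' c2 c3]; apply: cvgD; apply: cvgM => //; last exact: crho.
  apply: cvgM; first exact: cvg_cst.
  apply: cvgB; [exact: csnd|exact: cvg_cst].
have inU x y : (x - a) ^+ 2 + (y - b) ^+ 2 <= r ^+ 2 -> unit_disc (x +i* y).
  by move=> H; apply: (@plane_disc_unit_disc R a b r r0 sub_disc (x, y)).
have Ix : (\int[leb \x leb]_(w in plane_disc a b r) (Px w)%:E = 0)%E.
  apply: plane_disc_integral_slices => //; left => y.
  apply: (@slice_integral0 R (fun x => rho (x, y) * Reg (x, y)) (fun x => Px (x, y))) => x.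
  - rewrite lerBrDr => /inU/gd[_ gq _].
    have d1 : is_derive x 1 (fun x : R => rho (x, y)) (- 2 * (x - a)).
      rewrite /rho/=; apply: is_derive_eq; rewrite /GRing.scale/=; ring.
    have d2 := quad_deriv_partial_Re gq.
    have := is_deriveM d1 d2; rewrite /GRing.scale/= => /is_derive_eq; apply.
    by rewrite /Px/= /Reg/Red/=; ring.
  - rewrite lerBrDr => /inU xy.
    apply: (@continuous_comp _ _ _ (fun x => (x, y)) Px); last exact: cPx.
    by apply: (@cvg_pair _ _ _ (nbhs x) (nbhs x) (nbhs y) _ _ _ id (fun=> y));
      [exact: cvg_id|exact: cvg_cst].
  - by move=> H; rewrite /rho/= H; ring.
have Iy : (\int[leb \x leb]_(w in plane_disc a b r) (Py w)%:E = 0)%E.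
  apply: plane_disc_integral_slices => //; right => x.
  apply: (@slice_integral0 R (fun y => rho (x, y) * Img (x, y)) (fun y => Py (x, y))) => y.
  - rewrite lerBrDl => /inU/gd[_ gq _].
    have d1 : is_derive y 1 (fun y : R => rho (x, y)) (- 2 * (y - b)).
      rewrite /rho/=; apply: is_derive_eq; rewrite /GRing.scale/=; ring.
    have d2 := quad_deriv_partial_Im gq.
    have := is_deriveM d1 d2; rewrite /GRing.scale/= => /is_derive_eq; apply.
    by rewrite /Py/= /Img/Red/=; ring.
  - rewrite lerBrDl => /inU xy.
    apply: (@continuous_comp _ _ _ (fun y => (x, y)) Py); last exact: cPy.
    by apply: (@cvg_pair _ _ _ (nbhs y) (nbhs x) (nbhs y) _ _ _ (fun=> x) id);
      [exact: cvg_cst|exact: cvg_id].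
  - by move=> H; rewrite /rho/= H; ring.
have iPx := plane_disc_integrable r0 sub_disc cPx.
have iPy := plane_disc_integrable r0 sub_disc cPy.
have mB := measurable_plane_disc a b r.
(* [Px] and [Py] are the x-derivative of [rho * Re g] and the y-derivative of [rho * Im g]. By
   Cauchy-Riemann both contain [rho * Re g'], which cancels in the difference and leaves
   [-2 * Re ((z - c) * g)]. *)
transitivity (\int[leb \x leb]_(w in plane_disc a b r)
    ((- 2^-1)%:E * ((EFin \o Px) w - (EFin \o Py) w)))%E.
  apply: eq_integral => -[x y] /[1!inE] Bw; rewrite /= -EFinB -EFinM.
  have [H _ _] := gd _ (inU x y Bw).
  congr (_%:E); rewrite /Px /Py /Reg /Img /=.
  have -> : Re (f (x +i* y)) - Re (f (a +i* b)) = Re (f (x +i* y) - f (a +i* b)).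
    by case: (f _); case: (f _).
  by rewrite H; case: (g _) => p q /=; field.
rewrite integralZl//; last exact: integrableB.
by rewrite integralB// Ix Iy subee// mule0.
Qed.

Lemma Re_mean_value_le :
  (`|Re (f (a +i* b))|%:E * (leb \x leb) (plane_disc a b r) <=
   \int[leb \x leb]_(w in plane_disc a b r) (normc (f (w.1 +i* w.2)))%:E)%E.
Proof.
have mB := measurable_plane_disc a b r.
have /andP[_ B4] := plane_disc_measure_bounds a b r0.
have Boo : ((leb \x leb) (plane_disc a b r) < +oo)%E.
  by rewrite (le_lt_trans B4)// ltry.
have lf (x y : R) : unit_disc (x +i* y) -> lipschitz_at f (x +i* y).
  move=> /(analytic_strict_deriv af)[D] /strict_quad_deriv.
  exact: quad_deriv_lipschitz.
have iRe : (leb \x leb)%E.-integrable (plane_disc a b r)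
    (EFin \o (fun w : R * R => Re (f (w.1 +i* w.2)))).
  apply: plane_disc_integrable => // -[x y] /= /lf.
  exact: (lipschitz_continuous (@Re_lipschitz R)).
have iN : (leb \x leb)%E.-integrable (plane_disc a b r)
    (EFin \o (fun w : R * R => normc (f (w.1 +i* w.2)))).
  apply: plane_disc_integrable => // -[x y] /= /lf.
  exact: (lipschitz_continuous (@normc_lipschitz R)).
have iC : (leb \x leb)%E.-integrable (plane_disc a b r)
    (EFin \o (fun w : R * R => Re (f (a +i* b)))).
  by apply: plane_disc_integrable => // w _; exact: cvg_cst.
have E : (\int[leb \x leb]_(w in plane_disc a b r) (Re (f (w.1 +i* w.2)))%:E =
    (Re (f (a +i* b)))%:E * (leb \x leb) (plane_disc a b r))%E.
  have := mean_value_Re; under eq_integral do rewrite EFinB.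
  rewrite integralB// integral_cst// => /eqP.
  rewrite sube_eq ?add0e; first by move/eqP.
  - exact: integrable_fin_num.
  - rewrite fin_num_adde_defl// fin_numM// ge0_fin_numE//.
rewrite -[X in (X * _)%E]/(`|(Re (f (a +i* b)))%:E|)%E.
have -> : (leb \x leb)%E (plane_disc a b r) = `|(leb \x leb) (plane_disc a b r)|%E.
  by rewrite gee0_abs.
rewrite -abseM -E (le_trans (le_abse_integral _ _ _))//.
  by case/integrableP : iRe.
apply: ge0_subset_le_integral => //.
  by move=> w _; rewrite lee_fin normc_ge0.
by move=> w _; rewrite abse_ge0/= lee_fin normc_Re_le.
Qed.

End on_disc.

Lemma normcNi : normc (0 -i* 1 : R[i]) = 1.
Proof. by rewrite /ComplexField.Normc.normc expr0n sqrrN expr1n add0r sqrtr1. Qed.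

Lemma mul_i_analytic (U : set R[i]) (f : R[i] -> R[i]) :
  analytic_on U f -> analytic_on U (fun z => (0 -i* 1) * f z).
Proof.
move=> af z0 /af[a [r [r0 H]]]; exists (fun k => (0 -i* 1) * a k), r; split; [exact: r0|move=> z zr].
apply/cvg_normcP => e e0; have /cvg_normcP/(_ _ e0)[N HN] := H z zr.
exists N => n /HN; rewrite /series/=.
have -> : \sum_(0 <= k < n) (0 -i* 1) * a k * (z - z0) ^+ k =
    (0 -i* 1) * \sum_(0 <= k < n) a k * (z - z0) ^+ k.
  by rewrite mulr_sumr; apply: eq_bigr => k _; rewrite mulrA.
rewrite -mulrBr normcM.
by rewrite normcNi mul1r.
Qed.

(** The real-part estimate is applied to [f] and to [-i f], whose real part is [Im f]; adding the
    two costs the factor 2. *)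
Lemma normc_mean_value_le (f : R[i] -> R[i]) (a b r : R) :
  analytic_on (@unit_disc R) f -> 0 < r ->
  (forall w : R[i], normc (w - (a +i* b)) <= 2 * r -> unit_disc w) ->
  ((normc (f (a +i* b)))%:E * (leb \x leb) (plane_disc a b r) <=
   2%:E * \int[leb \x leb]_(w in plane_disc a b r) (normc (f (w.1 +i* w.2)))%:E)%E.
Proof.
move=> af r0 sub.
have H1 := Re_mean_value_le af r0 sub.
have H2 := Re_mean_value_le (mul_i_analytic af) r0 sub.
have RIE (z : R[i]) : Re ((0 -i* 1) * z) = Im z by case: z => p q /=; ring.
have nIE (z : R[i]) : normc ((0 -i* 1) * z) = normc z.
  by rewrite normcM normcNi mul1r.
rewrite RIE in H2.
move: H2; under eq_integral do rewrite nIE; move=> H2.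
rewrite -[2%:E]/(1 + 1)%:E EFinD ge0_muleDl// mul1e.
apply: le_trans (leeD H1 H2); rewrite -ge0_muleDl ?lee_fin//.
rewrite lee_wpmul2r//.
by rewrite -EFinD lee_fin normc_le_ReIm.
Qed.

End analytic_mean_value.

(** * Growth of functions in the tent space *)

Section real_estimates.
Variable R : realType.

Lemma dyadic_scale (x : R) : 0 < x <= 1 ->
  exists n : nat, 2 ^- n.+1 < x <= 2 ^- n.
Proof.
move=> /andP[x0 x1].
have [n0 Hn0] : exists n, 2 ^- n < x :> R.
  have [n xn] : exists n : nat, x^-1 < n%:R.
    by exists (Num.bound x^-1); apply: archi_boundP; rewrite invr_ge0 ltW.
  exists n; rewrite invf_plt ?posrE ?exprn_gt0//.
  by rewrite (lt_trans xn)// -natrX ltr_nat ltn_expl.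
have ex : exists n, 2 ^- n < x by exists n0.
case: (ex_minnP ex) => -[|n] Hn Hmin.
  by move: Hn; rewrite expr0 invr1 ltNge x1.
exists n; rewrite Hn/= leNgt; apply/negP => /Hmin.
by rewrite ltnn.
Qed.

Lemma norm_sin_le (x : R) : 0 <= x -> `|sin x| <= x.
Proof.
rewrite le_eqVlt => /predU1P[<-|x0]; first by rewrite sin0 normr0.
have [c _] := @MVT R sin cos 0 x x0 (fun y _ => is_derive_sin y)
  (continuous_subspaceT (@continuous_sin R)).
rewrite sin0 !subr0 => ->; rewrite normrM [`|x|]gtr0_norm// ler_piMl ?(ltW x0)//.
exact: cos_max.
Qed.

Lemma normc_circle (t : R) : normc (cos t +i* sin t) = 1.
Proof. by rewrite /ComplexField.Normc.normc cos2Dsin2 sqrtr1. Qed.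

Lemma circle_dist (t : R) : normc (1 - (cos t +i* sin t)) = 2 * `|sin (t / 2)|.
Proof.
have tE : t = (t / 2) *+ 2 by rewrite -mulr_natr divfK.
apply/eqP; rewrite -(@eqrXn2 _ 2%N)// ?normc_ge0 ?mulr_ge0// exprMn sqr_normcE/=.
rewrite real_normK ?num_real// add0r sqrrN.
rewrite {1 2}tE cos_mulr2n sin_mulr2n.
have := cos2Dsin2 (t / 2); move: (cos (t / 2)) (sin (t / 2)) => c s H; apply/eqP.
have -> : 1 - (c ^+ 2 *+ 2 - 1) = 2 * s ^+ 2.
  have -> : s ^+ 2 = 1 - c ^+ 2 by rewrite -H addrAC subrr add0r.
  by ring.
have -> : (2 * s ^+ 2) ^+ 2 + (c * s *+ 2) ^+ 2 = 2 ^+ 2 * s ^+ 2 * (c ^+ 2 + s ^+ 2).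
  by ring.
by rewrite H mulr1.
Qed.

Lemma circle_dist_le (t : R) : 0 <= t -> normc (1 - (cos t +i* sin t)) <= t.
Proof.
by move=> t0; rewrite circle_dist; have := @norm_sin_le (t / 2); rewrite divr_ge0//; lra.
Qed.

(** If x exceeds the threshold y, then (x/y)^(p-1) >= 1. With a well chosen y this takes the place
    of Jensen's inequality when passing from exponent 1 to exponent p. *)
Lemma le_add_powR (p x y : R) : 1 < p -> 0 <= x -> 0 < y ->
  x <= y + x `^ p * y `^ (1 - p).
Proof.
move=> p1 x0 y0; have [xy|yx] := leP x y.
  by rewrite (le_trans xy)// lerDl mulr_ge0// powR_ge0.
have xx0 : 0 < x by exact: lt_trans yx.
suff : x <= x `^ p * y `^ (1 - p) by lra.
have -> : x `^ p = x * x `^ (p - 1) by rewrite mulr_powRB1//; lra.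
rewrite -mulrA ler_peMr//.
have -> : 1 - p = - (p - 1) by ring.
rewrite powRN ler_pdivlMr ?powR_gt0// mul1r ge0_ler_powR ?nnegrE ?subr_ge0// ltW//.
Qed.

End real_estimates.

Section mean_value_power.
Variable R : realType.
Local Notation leb := (@lebesgue_measure R).

Lemma measurable_normc_powR (f : R[i] -> R[i]) (p a b r : R) :
  analytic_on (@unit_disc R) f -> 0 < r ->
  (forall w : R[i], normc (w - (a +i* b)) <= 2 * r -> unit_disc w) ->
  measurable_fun (plane_disc a b r : set (measurableTypeR R * measurableTypeR R))
    (fun w => (normc (f (w.1 +i* w.2)) `^ p)%:E).
Proof.
move=> af r0 sub; apply/measurable_EFinP; apply: (measurableT_comp (measurable_powR _)).
have /integrableP[+ _] : (leb \x leb)%E.-integrable (plane_disc a b r)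
    (EFin \o (fun w : R * R => normc (f (w.1 +i* w.2)))).
  apply: plane_disc_integrable => // -[x y] /=.
  move=> /(analytic_strict_deriv af)[D] /strict_quad_deriv/quad_deriv_lipschitz.
  exact: (lipschitz_continuous (@normc_lipschitz R)).
by move/measurable_EFinP.
Qed.

Lemma normc_powR_mean_value_le (f : R[i] -> R[i]) (p a b r : R) : 1 < p ->
  analytic_on (@unit_disc R) f -> 0 < r ->
  (forall w : R[i], normc (w - (a +i* b)) <= 2 * r -> unit_disc w) ->
  ((normc (f (a +i* b)) `^ p * r ^+ 2)%:E <=
   (4 `^ p)%:E * \int[leb \x leb]_(w in plane_disc a b r)
      (normc (f (w.1 +i* w.2)) `^ p)%:E)%E.
Proof.
move=> p1 af r0 sub; set X := normc _.
set I := (\int[_]_(w in _) _)%E.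
have I0 : (0 <= I)%E by apply: integral_ge0 => w _; rewrite lee_fin powR_ge0.
have [X0|X0] := eqVneq X 0.
  by rewrite X0 powR0 ?mul0r ?mule_ge0 ?lee_fin ?powR_ge0// gt_eqF// (lt_trans _ p1).
have {}X0 : 0 < X by rewrite lt_neqAle eq_sym X0 normc_ge0.
have [->|Ioo] := eqVneq I +oo%E.
  by rewrite gt0_muley ?lte_fin ?powR_gt0// leey.
have If : I \is a fin_num by rewrite ge0_fin_numE// ltey.
have mB := measurable_plane_disc a b r.
have /andP[B1 B4] := plane_disc_measure_bounds a b r0.
have Bf : (leb \x leb)%E (plane_disc a b r) \is a fin_num.
  by rewrite ge0_fin_numE// (le_lt_trans B4)// ltry.
have := normc_mean_value_le af r0 sub; rewrite -/X.
have mfp := @measurable_normc_powR f p a b r af r0 sub.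
(* With A the area, the mean value bound reads X A <= 2 (y A + y^(1-p) I). For y = X / 4 the first
   term is X A / 2 and moves to the left, leaving X A <= 4 y^(1-p) I, hence the constant 4^p. *)
have [y yE] : exists y, y = X / 4 by exists (X / 4).
have y0 : 0 < y by rewrite yE divr_gt0.
have H : (\int[leb \x leb]_(w in plane_disc a b r) (normc (f (w.1 +i* w.2)))%:E <=
   y%:E * (leb \x leb) (plane_disc a b r) + (y `^ (1 - p))%:E * I)%E.
  rewrite -integral_cst// -ge0_integralZl//; last 2 first.
  - by move=> w _; rewrite lee_fin powR_ge0.
  - by rewrite lee_fin powR_ge0.
  rewrite -ge0_integralD//; last 3 first.
  - by move=> w _; rewrite /= lee_fin ltW.
  - by move=> w _; rewrite mule_ge0// lee_fin powR_ge0.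
  - by apply: emeasurable_funM.
  apply: ge0_subset_le_integral => // w Bw.
    by rewrite /= -EFinM -EFinD lee_fin addr_ge0 ?mulr_ge0 ?powR_ge0// ltW.
  rewrite /= -EFinM -EFinD !lee_fin normc_ge0/= [_ `^ (1 - p) * _]mulrC.
  by rewrite le_add_powR// normc_ge0.
have two0 : (0 <= 2%:E :> \bar R)%E by rewrite lee_fin.
move=> HM; have := le_trans HM (lee_wpmul2l two0 H).
rewrite -(fineK If) -(fineK Bf) -!EFinM !lee_fin.
have : r ^+ 2 <= fine ((leb \x leb)%E (plane_disc a b r)).
  by rewrite -lee_fin fineK.
have : 0 <= fine I by rewrite fine_ge0.
move: (fine _) (fine I) => A J J0 rA XA.
have : X * A <= 4 * (y `^ (1 - p) * J) 
  by move: XA; move: (y `^ _) => Y; rewrite yE; nra.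
have -> : 1 - p = - (p - 1) by ring.
rewrite powRN yE powRM ?(ltW X0)// ?invr_ge0//.
have Xp : 0 < X `^ (p - 1) by exact: powR_gt0.
have -> : X `^ p = X * X `^ (p - 1) by rewrite mulr_powRB1 ?(ltW X0)//; lra.
have -> : (4 : R) `^ p = 4 * 4 `^ (p - 1) by rewrite mulr_powRB1//; lra.
have -> : (4^-1 : R) `^ (p - 1) = (4 `^ (p - 1))^-1.
  by rewrite -powR_inv1// -powRrM mulN1r powRN.
have F0 : 0 < (4 : R) `^ (p - 1) by exact: powR_gt0.
rewrite invfM invrK => H1; apply: (@le_trans _ _ (X * X `^ (p - 1) * A)).
  by rewrite ler_wpM2l// mulr_ge0 ?(ltW X0) ?(ltW Xp).
have -> : X * X `^ (p - 1) * A = (X * A) * X `^ (p - 1) by ring.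
rewrite -ler_pdivlMr//; apply: (le_trans H1).
by rewrite le_eqVlt; apply/orP; left; apply/eqP; ring.
Qed.

End mean_value_power.

(** * Geometry of the cones *)

Section cone.
Variable R : realType.

(** Solving z = e z0 + (1 - e) xi for z0 gives |e z0| <= e/4 + (1 - e) e/4 < e/2. *)
Lemma Gamma_half_disc (xi z : R[i]) (e : R) : 0 < e <= 1 ->
  normc xi = 1 -> normc (1 - xi) <= e / 4 -> normc (z - (1 - e)%:C) <= e / 4 ->
  Gamma_half xi z.
Proof.
move=> /andP[e0 e1] nxi xe ze; right.
have eC : e%:C != 0 by rewrite (inj_eq (@complexI R)) gt_eqF.
pose z0 := (z - (1 - e)%:C * xi) / e%:C.
exists z0.
  rewrite /= /z0 normcM normcV normc_real gtr0_norm// ltr_pdivrMr//.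
  have -> : z - (1 - e)%:C * xi = (z - (1 - e)%:C) + (1 - e)%:C * (1 - xi) by ring.
  rewrite (le_lt_trans (le_normcD _ _))// normcM normc_real.
  rewrite ger0_norm ?subr_ge0//.
  have := normc_ge0 (1 - xi); nra.
exists (1 - e); first by rewrite /= in_itv/= subr_ge0 e1/=; lra.
have -> : 1 - (1 - e) = e by ring.
by rewrite /z0 [e%:C * _]mulrC divfK// subrK.
Qed.

(** At parameter t on a segment, |z - xi| <= (3/2)(1 - t) while 1 - |z| >= (1 - t)/2. The central
    disc is the case t = 0. *)
Lemma Gamma_halfP (xi z : R[i]) : normc xi = 1 -> Gamma_half xi z ->
  normc z < 1 /\ normc (z - xi) <= 3 * (1 - normc z).
Proof.
move=> nxi H.
have {H}[z0 [z02 [t /=]]] : exists z0 : R[i], normc z0 < 2^-1 /\ segment_co z0 xi z.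
  case: H => [[_ /= z2]|[z0 /= z02 zs]]; last by exists z0.
  exists z; split => //; exists 0; first by rewrite /= in_itv/= lexx ltr01.
  by rewrite subr0 mul1r mul0r addr0.
rewrite in_itv/= => /andP[t0 t1] <-.
have n1 : normc ((1 - t)%:C * z0 + t%:C * xi) <= (1 - t) * normc z0 + t.
  rewrite (le_trans (le_normcD _ _))// !normcM !normc_real nxi mulr1.
  by rewrite !ger0_norm// subr_ge0 ltW.
have -> : (1 - t)%:C * z0 + t%:C * xi - xi = (1 - t)%:C * (z0 - xi).
  by rewrite rmorphB/=; ring.
rewrite normcM normc_real ger0_norm ?subr_ge0 ?(ltW t1)//.
have := normcB_le z0 xi; rewrite nxi => n2.
have := normc_ge0 z0; split; nra.
Qed.

End cone.

Section tent_space_growth.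
Variable R : realType.
Local Notation leb := (@lebesgue_measure R).

Definition cone_integral (p : R) (f : R[i] -> R[i]) (xi : R[i]) : \bar R :=
  area_integral (Gamma_half xi)
    (fun z => (normc (f z) `^ p / (1 - normc z ^+ 2))%:E).

Lemma cone_integrand_ge0 (p : R) (f : R[i] -> R[i]) (z : R[i]) : normc z < 1 ->
  0 <= normc (f z) `^ p / (1 - normc z ^+ 2).
Proof.
by move=> z1; rewrite divr_ge0 ?powR_ge0// subr_ge0 exprn_ile1 ?normc_ge0 ?ltW.
Qed.

Lemma cone_integral_ge0 (p : R) (f : R[i] -> R[i]) (xi : R[i]) : normc xi = 1 ->
  (0 <= cone_integral p f xi)%E.
Proof.
move=> nxi; rewrite mule_ge0 ?lee_fin ?invr_ge0 ?pi_ge0//.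
apply: integral_ge0 => w /(Gamma_halfP nxi)[w1 _].
by rewrite lee_fin cone_integrand_ge0.
Qed.

(** On the disc of radius e/4 about 1 - e, 1 - |z|^2 <= 5e/2, so the weight is at least 2/(5e). The
    mean value bound supplies 4^p and (e/4)^2, and 40 = 16 * 5/2; [pi] undoes the normalization of
    area. *)
Lemma cone_integral_lower_bound (p : R) (f : R[i] -> R[i]) (e t : R) :
  1 < p -> analytic_on (@unit_disc R) f -> 0 < e <= 1 -> 0 <= t <= e / 4 ->
  ((normc (f (1 - e)%:C) `^ p * e)%:E <=
   (40 * 4 `^ p * pi)%:E * cone_integral p f (cos t +i* sin t))%E.
Proof.
move=> p1 af /andP[e0 e1] /andP[t0 te].
have sub w : normc (w - ((1 - e) +i* 0)) <= 2 * (e / 4) -> unit_disc w.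
  move=> H; rewrite /unit_disc/=; have := le_normcD (w - (1 - e)%:C) (1 - e)%:C.
  rewrite subrK normc_real ger0_norm ?subr_ge0//; move: H.
  rewrite -[(1 - e) +i* 0]/((1 - e)%:C); lra.
have r0 : 0 < e / 4 by rewrite divr_gt0.
have mB := measurable_plane_disc (1 - e) 0 (e / 4).
have mf := @measurable_normc_powR _ f p _ _ _ af r0 sub.
have := normc_powR_mean_value_le p1 af r0 sub.
rewrite -[f (1 - e)%:C]/(f ((1 - e) +i* 0)); set X := normc (f _).
set I := (\int[_]_(w in _) _)%E => HI.
have c0 : 0 < 2 / (5 * e) by rewrite divr_gt0// mulr_gt0.
have HJ : ((2 / (5 * e))%:E * I <= pi%:E * cone_integral p f (cos t +i* sin t))%E.
  rewrite /cone_integral /area_integral muleA -EFinM mulfV ?gt_eqF ?pi_gt0// mul1e.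
  rewrite -ge0_integralZl//; last 2 first.
  - by move=> w _; rewrite lee_fin powR_ge0.
  - by rewrite lee_fin ltW.
  have BG w : plane_disc (1 - e) 0 (e / 4) w ->
      normc ((w.1 +i* w.2) - (1 - e)%:C) <= e / 4.
    rewrite /plane_disc/= => H.
    rewrite -(@ler_pXn2r _ 2%N) ?nnegrE ?normc_ge0 ?(ltW r0)// sqr_normcE/=.
    by rewrite subr0 in H *.
  apply: ge0_subset_le_integral.
  - move=> w /BG; apply: Gamma_half_disc; rewrite ?e0 ?normc_circle//.
    by rewrite (le_trans (circle_dist_le t0)).
  - by move=> w /(Gamma_halfP (normc_circle _))[w1 _]; rewrite lee_fin cone_integrand_ge0.
  - move=> w Bw; rewrite -EFinM !lee_fin mulr_ge0 ?powR_ge0 ?(ltW c0)//=.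
    have w1 : normc (w.1 +i* w.2) < 1.
      by apply: (@plane_disc_unit_disc R (1 - e) 0 (e / 4)).
    have := BG w Bw; set z := (w.1 +i* w.2) in w1 *.
    have := normc_dist_le z (1 - e)%:C 0; rewrite !subr0 normc_real.
    rewrite ger0_norm ?subr_ge0// (normc_distC _ z) => H1 H2.
    rewrite mulrC ler_wpM2l ?powR_ge0//.
    have z0 := normc_ge0 z.
    have d0 : 0 < 1 - normc z ^+ 2 by nra.
    rewrite -[2 / _]invrK lef_pV2 ?posrE ?invr_gt0// invf_div; nra.
apply: (@le_trans _ _ ((16 / e)%:E * (X `^ p * (e / 4) ^+ 2)%:E)%E).
  rewrite -EFinM lee_fin le_eqVlt; apply/orP; left; apply/eqP; field.
  by rewrite gt_eqF.
apply: (le_trans (lee_wpmul2l _ HI)); first by rewrite lee_fin divr_ge0// ltW.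
rewrite muleA -EFinM.
have -> : 16 / e * 4 `^ p = (40 * 4 `^ p) * (2 / (5 * e)).
  by field; rewrite gt_eqF.
rewrite [X in (X * _)%E]EFinM -muleA.
apply: (le_trans (lee_wpmul2l _ HJ)); first by rewrite lee_fin mulr_ge0// powR_ge0.
by rewrite muleA -EFinM.
Qed.

End tent_space_growth.

(** * Sufficiency of the dyadic condition *)

Section sufficiency.
Variable R : realType.
Local Notation leb := (@lebesgue_measure R).

Lemma lebesgue_itv_oc (a b : R) : a <= b -> leb `]a, b]%classic = (b - a)%:E.
Proof.
move=> ab; rewrite lebesgue_measure_itv/= lte_fin; case: ifPn => [_|].
  by rewrite EFinB.
by rewrite -leNgt => ba; congr (_%:E); lra.
Qed.

Lemma dyadic_intervalE (n : nat) (t : R) :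
  dyadic_interval n t <-> 2 ^- n.+1 < 1 - t <= 2 ^- n.
Proof.
rewrite /dyadic_interval/= in_itv/= !div1r.
by split => /andP[H1 H2]; apply/andP; split; lra.
Qed.

Lemma AT_space_dyadic_growth (p q : R) (f : R[i] -> R[i]) :
  1 < p -> 1 < q -> AT_space p q f ->
  exists (K : R) (x : nat -> R), [/\ 0 <= K, forall n, 0 <= x n,
    (\sum_(0 <= n <oo) (x n `^ q)%:E < +oo)%E &
    forall n t, dyadic_interval n t ->
      normc (f t%:C) <= K * (2 `^ (n%:R * (p^-1 + q^-1)) * x n)].
Proof.
move=> p1 q1 [af].
have p0 : 0 < p by exact: lt_trans p1.
have q0 : 0 < q by exact: lt_trans q1.
rewrite /AT_norm => /(lty_poweRy (invr_neq0 (lt0r_neq0 q0))); rewrite /circle_integral.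
pose Phi t := (cone_integral p f (cos t +i* sin t) `^ (q / p))%E.
rewrite -[(\int[_]_(_ in _) _)%E]/(\int[leb]_(t in `[0%R, (2 * pi)%R]) Phi t)%E => foo.
(* The shift by 3 serves the cone bound: for [t] in the n-th dyadic interval, 1 - t > 2^-(n+1), so
   every angle in [J n] is at most (1 - t)/4. *)
pose J n : set R := `]2 ^- n.+4, 2 ^- n.+3]%classic.
(* The infimum is a constant below [Phi] on [J n], which is all that the disjoint lower sums need,
   and the pointwise bound on [f] holds for every angle of [J n], hence for the infimum. *)
pose v n := ereal_inf [set Phi t | t in J n].
have Phi0 t : (0 <= Phi t)%E by exact: poweR_ge0.
have v0 n : (0 <= v n)%E by apply: le_ereal_inf_tmp => _ [t _ <-].
have lJ n : leb (J n) = (2 ^- n.+4)%:E.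
  have E : 2 ^- n.+3 = 2 * 2 ^- n.+4 :> R.
    by rewrite [2 ^+ n.+4]exprS; field; rewrite expf_neq0.
  have P : 0 < 2 ^- n.+4 :> R by rewrite invr_gt0 exprn_gt0.
  by rewrite lebesgue_itv_oc; [congr (_%:E)|]; lra.
have sv : (\sum_(n <oo) v n * leb (J n) < +oo)%E.
  apply: le_lt_trans foo; apply: series_le_integral => //.
  - by move=> n; exact: measurable_itv.
  - move=> n t; rewrite /J/= !in_itv/= => /andP[t1 t2].
    have := @pi_ge2 R; have : 2 ^- n.+3 <= 1 :> R.
      by rewrite invf_le1 ?exprn_gt0// exprn_ege1// ler1n.
    have : 0 < 2 ^- n.+4 :> R by rewrite invr_gt0 exprn_gt0.
    move=> A B C; apply/andP; split; lra.
  - apply: ltn_trivIset => n2 n1 n12; rewrite -subset0 => t [].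
    rewrite /J/= !in_itv/= => /andP[t1 t2] /andP[t3 t4].
    have : t <= 2 ^- n1.+4.
      by rewrite (le_trans t4)// lef_pV2 ?posrE ?exprn_gt0// ler_eXn2l ?ltr1n//.
    by rewrite leNgt t1.
  - by move=> n t Jt; apply: ereal_inf_lbound; exists t.
have vf n : v n \is a fin_num.
  rewrite ge0_fin_numE// ltey; apply/eqP => vy.
  have := @nneseries_lim_ge R (fun k => v k * leb (J k))%E xpredT 0 n.+1
    (fun k _ _ => mule_ge0 (v0 k) (measure_ge0 leb (J k))).
  rewrite big_nat_recr//= vy lJ gt0_mulye ?lte_fin ?invr_gt0 ?exprn_gt0//.
  rewrite addey; last first.
    by rewrite gt_eqF// (lt_le_trans ltNy0)// sume_ge0// => i _; rewrite mule_ge0.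
  by move=> /(lt_le_trans sv); rewrite ltxx.
pose V n := fine (v n).
have V0 n : 0 <= V n by rewrite fine_ge0.
pose K := 40 * 4 `^ p * pi : R.
have K0 : 0 < K by rewrite !mulr_gt0 ?powR_gt0 ?pi_gt0.
(* The q-th power of the n-th term is 16 times [V n] times the length of [J n]; the 2 in [2 * K]
   accounts for 1 - t > 2^-(n+1) instead of 2^-n. *)
exists ((2 * K) `^ p^-1), (fun n => (2 ^- n * V n) `^ q^-1); split.
- exact: powR_ge0.
- by move=> n; exact: powR_ge0.
- have E n : (((2 ^- n * V n) `^ q^-1) `^ q)%:E = (16%:E * (v n * leb (J n)))%E.
    rewrite -powRrM mulVf ?gt_eqF// powRr1 ?mulr_ge0 ?invr_ge0 ?exprn_ge0//.
    rewrite lJ -(fineK (vf n)) -!EFinM -/(V n); congr (_%:E).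
    by rewrite !exprS; field; rewrite expf_neq0.
  rewrite (eq_eseriesr (fun n _ => E n)) nneseriesZl; last first.
    by move=> n _; rewrite mule_ge0.
  by rewrite lte_mul_pinfty.
move=> n t /dyadic_intervalE/andP[t1 t2]; cbv beta.
set X := normc _.
have X0 : 0 <= X by exact: normc_ge0.
have e0 : 0 < 1 - t by rewrite (lt_trans _ t1)// invr_gt0 exprn_gt0.
have e1 : 1 - t <= 1.
  by rewrite (le_trans t2)// invf_le1 ?exprn_gt0// exprn_ege1// ler1n.
have HV : (X `^ p * 2 ^- n.+1 / K) `^ (q / p) <= V n.
  rewrite -lee_fin fineK//; apply: le_ereal_inf_tmp => _ [th + <-].
  rewrite /J/= in_itv/= => /andP[th1 th2].
  rewrite /Phi -poweR_EFin; apply: gt0_ler_poweR.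
  - by rewrite divr_ge0 ?ltW.
  - rewrite in_itv/= leey andbT lee_fin.
    by rewrite divr_ge0 ?(ltW K0)// mulr_ge0 ?powR_ge0// invr_ge0 exprn_ge0.
  - by rewrite in_itv/= leey andbT cone_integral_ge0// normc_circle.
  have th0 : 0 <= th by rewrite ltW// (lt_trans _ th1)// invr_gt0 exprn_gt0.
  have the : th <= (1 - t) / 4.
    have : 2 ^- n.+3 = 2 ^- n.+1 / 4 :> R.
      by rewrite [2 ^+ n.+3]exprS [2 ^+ n.+2]exprS; field; rewrite expf_neq0.
    lra.
  have := @cone_integral_lower_bound R p f (1 - t) th p1 af.
  rewrite e0 e1 th0 the => /(_ isT isT); rewrite subKr -/X -/K => H.
  have -> : X `^ p * 2 ^- n.+1 / K = K^-1 * (X `^ p * 2 ^- n.+1) by rewrite mulrC.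
  rewrite EFinM lee_pdivrMl// (le_trans _ H)// lee_fin ler_wpM2l ?powR_ge0// ltW//.
have : X * (2 ^- n.+1 / K) `^ p^-1 <= V n `^ q^-1.
  have -> : X * (2 ^- n.+1 / K) `^ p^-1 = ((X `^ p * 2 ^- n.+1 / K) `^ (q / p)) `^ q^-1.
    rewrite -powRrM.
    have -> : q / p * q^-1 = p^-1 by field; rewrite !gt_eqF.
    rewrite -mulrA powRM ?powR_ge0//; last first.
      by rewrite divr_ge0 ?(ltW K0)// invr_ge0 exprn_ge0.
    by rewrite -powRrM divff ?gt_eqF// powRr1.
  apply: ge0_ler_powR; rewrite ?nnegrE ?powR_ge0//.
  by rewrite invr_ge0 ltW.
have E1 : 2 ^- n.+1 / K = (2 * K)^-1 * 2 ^- n by rewrite exprS !invfM mulrAC.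
have K20 : 0 < 2 * K by rewrite mulr_gt0.
rewrite E1 [((2 * K)^-1 * _) `^ _]powRM ?invr_ge0 ?exprn_ge0// ?(ltW K20)//.
rewrite [(2 ^- n * V n) `^ _]powRM ?invr_ge0 ?exprn_ge0//.
have P2 (u : R) : (2 ^- n : R) `^ u = 2 `^ (- (n%:R * u)).
  by rewrite -powR_invn// -powRrM mulNr.
have PV (y u : R) : 0 <= y -> y^-1 `^ u = (y `^ u)^-1.
  by move=> y0; rewrite -(powR_inv1 y0) -powRrM mulN1r powRN.
rewrite (PV (2 * K)) ?(ltW K20)// !P2 [2 `^ (- (n%:R * p^-1))]powRN.
rewrite [2 `^ (- (n%:R * q^-1))]powRN mulrDr powRD; last by rewrite pnatr_eq0 implybT.
have A0 : 0 < (2 * K) `^ p^-1 by exact: powR_gt0.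
have B0 : 0 < 2 `^ (n%:R * p^-1) :> R by exact: powR_gt0.
have C0 : 0 < 2 `^ (n%:R * q^-1) :> R by exact: powR_gt0.
move: ((2 * K) `^ p^-1) (2 `^ (n%:R * p^-1)) (2 `^ (n%:R * q^-1)) (V n `^ q^-1) A0 B0 C0.
move=> A B C W A0 B0 C0 H.
have -> : A * (B * C * (C^-1 * W)) = W * (A * B) by field; rewrite gt_eqF.
by rewrite -ler_pdivrMr ?mulr_gt0// invfM.
Qed.

Lemma I_well_defined_of_dyadic_sum (p q q' : R)
    (mu : {finite_measure set (measurableTypeR R) -> \bar R}) :
  1 < p -> 1 < q -> q^-1 + q'^-1 = 1 ->
  (\sum_(0 <= n <oo)
     (mu (@dyadic_interval R n) *
      (2 `^ (n%:R * (p^-1 + q^-1)))%:E) `^ q' < +oo)%E ->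
  I_well_defined p q mu.
Proof.
move=> p1 q1 qq' Hsum f ATf z z1.
have q0 : 0 < q by exact: lt_trans q1.
have q'0 : 0 < q'.
  rewrite -invr_gt0; have : q^-1 < 1 by rewrite invf_lt1. lra.
have [K [x [K0 x0 sx Hx]]] := AT_space_dyadic_growth p1 q1 ATf.
pose m n := fine (mu (@dyadic_interval R n)).
have mE n : mu (@dyadic_interval R n) = (m n)%:E.
  by rewrite fineK// fin_num_measure//; exact: measurable_itv.
have m0 n : 0 <= m n by rewrite fine_ge0.
pose s n : R := 2 `^ (n%:R * (p^-1 + q^-1)).
have s0 n : 0 <= s n by exact: powR_ge0.
have z1' : 0 < 1 - normc z by rewrite subr_gt0.
pose C := K / (1 - normc z).
have C0 : 0 <= C by rewrite divr_ge0// ltW.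
apply: (@le_lt_trans _ _
    (\sum_(n <oo) (C * (s n * x n))%:E * mu (@dyadic_interval R n))%E).
  apply: integral_le_series.
  - by move=> n; rewrite lee_fin mulr_ge0// mulr_ge0.
  - by move=> n; exact: measurable_itv.
  - by move=> t _; rewrite lee_fin divr_ge0 ?normc_ge0.
  move=> t; rewrite /= in_itv/= => /andP[t0 t1].
  have [|n Hn] := @dyadic_scale R (1 - t); first by apply/andP; split; lra.
  exists n; first exact/dyadic_intervalE.
  have tz : 1 - normc z <= normc (1 - t%:C * z).
    have := le_normcD (1 - t%:C * z) (t%:C * z).
    rewrite subrK ComplexField.Normc.normc1 normcM normc_real ger0_norm//.
    have := normc_ge0 z; nra.
  rewrite lee_fin /C mulrAC ler_pM ?normc_ge0 ?invr_ge0 ?normc_ge0//.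
    by apply: Hx; exact/dyadic_intervalE.
  by rewrite lef_pV2// posrE// (lt_le_trans _ tz).
have b0 n : 0 <= m n * s n by rewrite mulr_ge0.
have E n : ((mu (@dyadic_interval R n) * (s n)%:E) `^ q' = ((m n * s n) `^ q')%:E)%E.
  by rewrite mE -EFinM poweR_EFin.
rewrite (eq_eseriesr (fun n _ => E n)) in Hsum.
apply: (@le_lt_trans _ _ (\sum_(n <oo) C%:E *
    (((m n * s n) `^ q')%:E + (x n `^ q)%:E))%E).
  apply: lee_nneseries => n _; first by rewrite mE lee_fin mulr_ge0// mulr_ge0// mulr_ge0.
  rewrite mE -EFinD -!EFinM lee_fin -mulrA ler_wpM2l//.
  have -> : s n * x n * m n = (m n * s n) * x n by ring.
  rewrite (le_trans (conjugate_powR (b0 n) (x0 n) q'0 q0 _)) ?[q'^-1 + _]addrC//.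
  have qi : 0 < q^-1 by rewrite invr_gt0.
  have q'i : 0 < q'^-1 by rewrite invr_gt0.
  by rewrite lerD// ler_piMr ?powR_ge0//; lra.
rewrite nneseriesZl; last by move=> n _; rewrite lee_fin addr_ge0 ?powR_ge0.
rewrite nneseriesD; last 2 first.
- by move=> n _ _; rewrite lee_fin powR_ge0.
- by move=> n _ _; rewrite lee_fin powR_ge0.
rewrite lte_mul_pinfty ?lee_fin// lte_add_pinfty//.
Qed.

End sufficiency.

(** * Landau's theorem and slowly varying weights *)

Section bounded_series.
Variable R : realType.
Implicit Types x y : nat -> R.

Lemma series_ordE x N : series x N = \sum_(n < N) x n.
Proof. by rewrite /series/= big_mkord. Qed.

Lemma bounded_series_cvg x (B : R) : (forall n, 0 <= x n) ->
  (forall N, \sum_(n < N) x n <= B) -> cvgn (series x).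
Proof.
move=> x0 xB; apply: nondecreasing_is_cvgn.
  by apply/nondecreasing_seqP => n; rewrite !series_ordE big_ord_recr/= lerDl.
by exists B => _ [n _ <-]; rewrite series_ordE.
Qed.

Lemma partial_sum_le_lim x (B : R) N : (forall n, 0 <= x n) ->
  (forall N, \sum_(n < N) x n <= B) -> \sum_(n < N) x n <= limn (series x).
Proof.
move=> x0 xB; have := nondecreasing_cvgn_le _ (bounded_series_cvg x0 xB) N.
rewrite series_ordE; apply.
by apply/nondecreasing_seqP => n; rewrite !series_ordE big_ord_recr/= lerDl.
Qed.

Lemma lim_series_le_bound x (B : R) : (forall n, 0 <= x n) ->
  (forall N, \sum_(n < N) x n <= B) -> limn (series x) <= B.
Proof.
move=> x0 xB; apply: limr_le; first exact: bounded_series_cvg xB.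
by apply: nearW => n; rewrite series_ordE.
Qed.

Lemma term_le_lim x (B : R) k : (forall n, 0 <= x n) ->
  (forall N, \sum_(n < N) x n <= B) -> x k <= limn (series x).
Proof.
move=> x0 xB; apply: le_trans (partial_sum_le_lim k.+1 x0 xB).
by rewrite big_ord_recr/= lerDr sumr_ge0.
Qed.

Definition natdist (n k : nat) : nat := ((n - k) + (k - n))%N.

Lemma natdist_triangle m n k : (natdist m k <= natdist m n + natdist n k)%N.
Proof. rewrite /natdist; lia. Qed.

(** Only the bound 2/(1 - a) is used later; the term [- a ^+ k] strengthens it so that the induction
    on [k] closes, the step reducing to (1 - a)^2 >= 0. *)
Lemma sum_expr_natdist_le (a : R) N k : 0 < a < 1 ->
  \sum_(n < N) a ^+ natdist n k <= (2 - a ^+ k) / (1 - a).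
Proof.
move=> /andP[a0 a1]; have a1' : 0 < 1 - a by rewrite subr_gt0.
elim: k N => [|k ih] N.
  rewrite ler_pdivlMr// expr0.
  have -> : \sum_(n < N) a ^+ natdist n 0 = \sum_(n < N) a ^+ n.
    by apply: eq_bigr => n _; rewrite /natdist subn0 sub0n addn0.
  have := subrX1 a N; rewrite mulrC => H.
  have -> : (\sum_(n < N) a ^+ n) * (1 - a) = 1 - a ^+ N.
    by rewrite -[RHS]opprB H; ring.
  have := exprn_ge0 N (ltW a0); lra.
case: N => [|N].
  rewrite big_ord0 divr_ge0 ?(ltW a1')// subr_ge0.
  have := exprn_ile1 k.+1 (ltW a0) (ltW a1); lra.
rewrite big_ord_recl/= /natdist sub0n subn0 add0n.
under eq_bigr do rewrite /bump/= add1n !subSS.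
rewrite (le_trans (lerD (lexx _) (ih N)))// !ler_pdivlMr// mulrDl divfK ?gt_eqF//.
have := exprn_ge0 k (ltW a0); rewrite exprS; move: (a ^+ k) => t t0.
have := mulr_ge0 t0 (sqr_ge0 (1 - a)); nra.
Qed.

End bounded_series.

Section landau.
Variable R : realType.

(** The right side is the integral of t^(-q) over [x, y], and the integrand is at least y^(-q). The
    proof uses only 1 + u <= exp u, once for the power and once for the logarithm. *)
Lemma powR_telescope (x y q : R) : 1 < q -> 0 < x -> x <= y ->
  (y - x) / y `^ q <= (x `^ (1 - q) - y `^ (1 - q)) / (q - 1).
Proof.
move=> q1 x0 xy; have y0 : 0 < y by exact: lt_le_trans xy.
have r0 : 0 < q - 1 by rewrite subr_gt0.
have yq : 0 < y `^ (q - 1) by exact: powR_gt0.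
have -> : y `^ q = y * y `^ (q - 1) by rewrite mulr_powRB1 ?(ltW y0)//; lra.
have -> : 1 - q = - (q - 1) by ring.
rewrite !powRN.
have u0 : 0 < x / y by rewrite divr_gt0.
have H : 1 + (q - 1) * (1 - x / y) <= y `^ (q - 1) / x `^ (q - 1).
  have -> : y `^ (q - 1) / x `^ (q - 1) = expR (- ((q - 1) * ln (x / y))).
    rewrite -powRN -mulNr.
    rewrite ln_div ?posrE//.
    have E (z : R) r : 0 < z -> z `^ r = expR (r * ln z).
      by move=> z0; rewrite /powR gt_eqF.
    by rewrite !E// -expRD; congr expR; ring.
  apply: le_trans (expR_ge1Dx _).
  have : 1 + ln (x / y) <= x / y by rewrite -[leRHS](lnK u0) expR_ge1Dx.
  nra.
rewrite ler_pdivlMr// -(@ler_pM2l _ (y `^ (q - 1)))//.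
have -> : y `^ (q - 1) * ((y - x) / (y * y `^ (q - 1)) * (q - 1)) =
    (q - 1) * (1 - x / y) by field; rewrite !gt_eqF.
rewrite [leRHS]mulrBr divff ?gt_eqF//; lra.
Qed.

(* Abel-Dini: for a divergent series of positive terms [a_n] with partial sums
   [T_n], the series of [a_n / T_n] diverges while that of [a_n / T_n ^ q]
   converges. *)
Lemma landau_bounded (q q' : R) (b : nat -> R) : 1 < q -> q^-1 + q'^-1 = 1 ->
  (forall n, 0 <= b n) ->
  (forall c : nat -> R, (forall n, 0 <= c n) ->
     (exists E, forall N, \sum_(n < N) c n `^ q <= E) ->
     exists B, forall N, \sum_(n < N) c n * b n <= B) ->
  exists B, forall N, \sum_(n < N) b n `^ q' <= B.
Proof.
move=> q1 qq' b0 Hc; apply: contrapT => /forallNP unb.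
have q0 : 0 < q by exact: lt_trans q1.
have q'V : 0 < q'^-1.
  have : q^-1 < 1 by rewrite invf_lt1. lra.
have q'0 : 0 < q' by rewrite -invr_gt0.
have q'E : (q' - 1) * q = q'.
  have -> : q'= (1 - q^-1)^-1 by rewrite -[LHS]invrK; congr _^-1; lra.
  by field; rewrite !gt_eqF// subr_gt0.
pose a n := b n `^ q'.
have a0 n : 0 <= a n by exact: powR_ge0.
(* The initial 1 keeps the denominators positive even if the first terms of [b] vanish. *)
pose T N := 1 + \sum_(n < N) a n.
have TS n : T n.+1 = T n + a n by rewrite /T big_ord_recr/= addrA.
have T1 n : 1 <= T n by rewrite lerDl sumr_ge0.
have T0 n : 0 < T n by rewrite (lt_le_trans _ (T1 n)).
have Tmono m n : (m <= n)%N -> T m <= T n.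
  by move=> mn; apply: (@nondecreasing_seqP _ _ T).1 => // k; rewrite TS lerDl.
(* Since (q' - 1) q = q', this choice gives [c n * b n = a n / T n.+1] and makes the q-th power of
   [c n] equal to a_n / T_{n+1}^q. *)
pose c n := b n `^ (q' - 1) / T n.+1.
have c0 n : 0 <= c n by rewrite divr_ge0 ?powR_ge0// ltW.
have [||B HB] := Hc c; first exact: c0.
  exists (q - 1)^-1 => N.
  have r0 : 0 < q - 1 by rewrite subr_gt0.
  have cq n : c n `^ q <= (T n `^ (1 - q) - T n.+1 `^ (1 - q)) / (q - 1).
    rewrite /c powRM ?powR_ge0 ?invr_ge0 ?(ltW (T0 _))// -powRrM q'E -/(a n).
    have -> : a n = T n.+1 - T n by rewrite TS addrC addKr.
    rewrite -(powR_inv1 (ltW (T0 n.+1))) -powRrM mulN1r powRN.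
    by apply: powR_telescope => //; exact: Tmono.
  apply: (@le_trans _ _ (\sum_(n < N) (T n `^ (1 - q) - T n.+1 `^ (1 - q)) / (q - 1))).
    by apply: ler_sum => n _; exact: cq.
  rewrite -mulr_suml.
  have -> : \sum_(n < N) (T n `^ (1 - q) - T n.+1 `^ (1 - q)) =
      T 0%N `^ (1 - q) - T N `^ (1 - q).
    elim: N => [|N ih]; first by rewrite big_ord0 subrr.
    by rewrite big_ord_recr/= ih; ring.
  rewrite ler_piMl ?invr_ge0 ?(ltW r0)// /T big_ord0 addr0 powR1.
  by rewrite gerBl powR_ge0.
have cb n : c n * b n = a n / T n.+1.
  by rewrite /c mulrAC [_ * b n]mulrC mulr_powRB1.
pose P N := \sum_(n < N) c n * b n.
have PS n : P n.+1 = P n + a n / T n.+1 by rewrite /P big_ord_recr/= cb.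
(* Cauchy's criterion for the bounded sums [P]: otherwise they would increase by 1/4 infinitely
   often. Past [N0], the unbounded [T] doubles, which forces an increase of at least 1/2. *)
have [N0 HN0] : exists N0, forall N, (N0 <= N)%N -> P N <= P N0 + 2^-1 / 2.
  apply: contrapT => /forallNP H.
  have step k : exists N, k%:R / 4 <= P N.
    elim: k => [|k [N kN]]; first by exists 0%N; rewrite mul0r /P big_ord0.
    have /existsNP[M /not_implyP[_ /negP]] := H N.
    by rewrite -ltNge => HM; exists M; rewrite -natr1 mulrDl; lra.
  have [k Bk] : exists k : nat, B * 4 < k%:R.
    exists (Num.bound (`|B| * 4)); rewrite (le_lt_trans _ (archi_boundP _)) ?mulr_ge0//.
    by rewrite ler_wpM2r// ler_norm.
  have [N kN] := step k; have := HB N; rewrite -/(P N); lra.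
have [N TN] : exists N, 2 * T N0 <= T N.
  have /existsNP[N /negP] := unb (2 * T N0).
  by rewrite -ltNge => HN; exists N; rewrite ltW// (lt_le_trans HN)// lerDr.
have N0N : (N0 <= N)%N.
  rewrite leqNgt; apply/negP => /ltnW/Tmono; have := T0 N0; lra.
have := HN0 N N0N.
have : (T N - T N0) / T N <= P N - P N0.
  rewrite -(subnK N0N) addnC; elim: (N - N0)%N => [|k ih].
    by rewrite addn0 !subrr mul0r.
  rewrite addnS PS.
  have -> : (T (N0 + k).+1 - T N0) / T (N0 + k).+1 =
      (T (N0 + k)%N - T N0) / T (N0 + k).+1 + a (N0 + k)%N / T (N0 + k).+1.
    by rewrite TS; ring.
  have : (T (N0 + k)%N - T N0) / T (N0 + k).+1 <= (T (N0 + k)%N - T N0) / T (N0 + k)%N.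
    rewrite ler_wpM2l ?subr_ge0 ?Tmono ?leq_addr// lef_pV2 ?posrE//.
    exact: Tmono.
  lra.
have : 2^-1 <= (T N - T N0) / T N by rewrite ler_pdivlMr//; lra.
lra.
Qed.

End landau.

Section slow_weights.
Variable R : realType.

Lemma slow_weights (p q : R) (c : nat -> R) (E : R) :
  1 < p -> 1 < q -> p^-1 + q^-1 < 1 -> (forall n, 0 <= c n) ->
  (forall N, \sum_(n < N) c n `^ q <= E) ->
  exists (w : nat -> R) (a E' : R), [/\ 2^-1 <= a < 1,
    forall n, 2 `^ (n%:R * (p^-1 + q^-1)) * c n <= w n,
    forall n k, (n <= k)%N -> w n <= w k * a ^+ (k - n),
    forall n k, (k <= n)%N -> w n * 2 ^- (n - k) <= w k * a ^+ (n - k) &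
    (forall j m, (j <= m)%N ->
      w j `^ p * 2 ^- j <= w m `^ p * 2 ^- m * a ^+ (m - j)) /\
    (forall N, \sum_(m < N) w m `^ q * 2 `^ (- (m%:R * (1 + q / p))) <= E')].
Proof.
move=> p1 q1; set s := p^-1 + q^-1 => s1 c0 cE.
have p0 : 0 < p by exact: lt_trans p1.
have q0 : 0 < q by exact: lt_trans q1.
have pV : 0 < p^-1 by rewrite invr_gt0.
have qV : 0 < q^-1 by rewrite invr_gt0.
(* [e] is the exponential rate at which the smoothed factor may vary. e < 1/q gives both e < s and
   (s - e) p > 1; e < 1 - s keeps the growth of [w] below 2^n. *)
pose e := Num.min q^-1 (1 - s) / 2.
have [e0 eq es] : [/\ 0 < e, e < q^-1 & e < 1 - s].
  have m0 : 0 < Num.min q^-1 (1 - s) by rewrite lt_min qV subr_gt0.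
  have m1 : Num.min q^-1 (1 - s) <= q^-1 by rewrite ge_min lexx.
  have m2 : Num.min q^-1 (1 - s) <= 1 - s by rewrite ge_min lexx orbT.
  by rewrite /e; move: (Num.min _ _) m0 m1 m2 => m m0 m1 m2; split; lra.
clearbody e.
have pow_lt1 (u : R) : u < 0 -> 2 `^ u < 1 :> R.
  move=> u0; rewrite -[ltRHS](@powRr0 _ 2) /powR pnatr_eq0 ltr_expR mul0r.
  by rewrite nmulr_rlt0// ln_gt0// ltr1n.
pose mu := 2 `^ (- (e * q)) : R.
have mu0 : 0 < mu by exact: powR_gt0.
have mu1 : mu < 1 by apply: pow_lt1; rewrite oppr_lt0 mulr_gt0.
pose x k n := c n `^ q * mu ^+ natdist n k.
have x0 k n : 0 <= x k n by rewrite mulr_ge0 ?powR_ge0// exprn_ge0// ltW.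
have xE k N : \sum_(n < N) x k n <= E.
  apply: le_trans (cE N); apply: ler_sum => n _.
  by rewrite ler_piMr ?powR_ge0// exprn_ile1// ltW.
pose h k := limn (series (x k)).
have h0 k : 0 <= h k by exact: le_trans (x0 k 0%N) (term_le_lim _ (x0 k) (xE k)).
have hc k : c k `^ q <= h k.
  apply: le_trans (term_le_lim k (x0 k) (xE k)).
  by rewrite /x /natdist subnn addn0 expr0 mulr1.
(* This is the triangle inequality for [natdist], applied term by term. *)
have hslow j k : h j * mu ^+ natdist j k <= h k.
  rewrite -ler_pdivlMr ?exprn_gt0//; apply: lim_series_le_bound (x0 j) _ => N.
  rewrite ler_pdivlMr ?exprn_gt0// mulr_suml.
  apply: le_trans (partial_sum_le_lim N (x0 k) (xE k)).
  apply: ler_sum => n _; rewrite /x -mulrA -exprD ler_wpM2l ?powR_ge0//.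
  by rewrite ler_wiXn2l ?(ltW mu0) ?(ltW mu1)// natdist_triangle.
have E0 : 0 <= E by have := cE 0%N; rewrite big_ord0.
have hsum N : \sum_(k < N) h k <= E * (2 / (1 - mu)).
  have cv : (fun M => \sum_(k < N) series (x k) M) @ \oo --> \sum_(k < N) h k.
    elim: N => [|N ih].
      rewrite big_ord0 (_ : (fun=> _) = fun=> 0); first exact: cvg_cst.
      by apply/funext => M; rewrite big_ord0.
    rewrite big_ord_recr/= (_ : (fun=> _) =
        fun M => \sum_(k < N) series (x k) M + series (x N) M); last first.
      by apply/funext => M; rewrite big_ord_recr.
    exact: (cvgD ih (bounded_series_cvg (x0 N) (xE N))).
  rewrite -(cvg_lim _ cv)//; apply: limr_le; first by apply/cvg_ex; eexists; exact: cv.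
  apply: nearW => M; under eq_bigr do rewrite series_ordE.
  rewrite exchange_big/=.
  apply: (@le_trans _ _ (\sum_(n < M) c n `^ q * (2 / (1 - mu)))).
    apply: ler_sum => n _; rewrite /x -mulr_sumr ler_wpM2l ?powR_ge0//.
    have := @sum_expr_natdist_le R mu N n; rewrite mu0 mu1 => /(_ isT).
    under eq_bigr do rewrite /natdist addnC.
    move=> /le_trans; apply; rewrite ler_wpM2r ?invr_ge0 ?subr_ge0 ?(ltW mu1)//.
    by rewrite gerBl exprn_ge0// ltW.
  by rewrite -mulr_suml ler_wpM2r ?divr_ge0 ?subr_ge0 ?(ltW mu1).
pose w k := 2 `^ (k%:R * s) * h k `^ q^-1.
have w0 k : 0 <= w k by rewrite mulr_ge0 ?powR_ge0.
have P2 (u : R) (n : nat) : (2 `^ u) ^+ n = 2 `^ (n%:R * u) :> R.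
  by rewrite -powR_mulrn ?powR_ge0// -powRrM mulrC.
have P2V (n : nat) : 2 ^- n = 2 `^ (- n%:R) :> R by rewrite powR_invn.
have PD (u v : R) : 2 `^ (u + v) = 2 `^ u * 2 `^ v :> R.
  by rewrite powRD// pnatr_eq0 implybT.
have hroot j k : h j `^ q^-1 <= h k `^ q^-1 * 2 `^ ((natdist j k)%:R * e).
  have : (h j * mu ^+ natdist j k) `^ q^-1 <= h k `^ q^-1.
    apply: ge0_ler_powR; rewrite ?nnegrE ?(ltW qV)//.
    by rewrite mulr_ge0// exprn_ge0// ltW.
  rewrite powRM ?exprn_ge0 ?(ltW mu0)// P2 -powRrM.
  have -> : (natdist j k)%:R * - (e * q) / q = - ((natdist j k)%:R * e).
    by field; rewrite gt_eqF.
  by rewrite powRN ler_pdivrMr// powR_gt0.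
(* One ratio serves all decay conditions. The entry 1/2 is for the cone integral, whose layers
   closest to the circle decay like 2^-j. *)
pose a := Num.max (Num.max (2 `^ (e - s)) (2 `^ (s + e - 1)))
  (Num.max (2 `^ (1 - (s - e) * p)) 2^-1) : R.
have a1 : 2 `^ (e - s) <= a by rewrite /a !le_max lexx.
have a2 : 2 `^ (s + e - 1) <= a by rewrite /a !le_max lexx !orbT.
have a3 : 2 `^ (1 - (s - e) * p) <= a by rewrite /a !le_max lexx !orbT.
have a4 : 2^-1 <= a by rewrite /a !le_max lexx !orbT.
have al1 : a < 1.
  rewrite /a !gt_max !pow_lt1 ?invf_lt1 ?ltr1n//=; last 3 first.
  - have : 1 < (s - e) * p; last by lra.
    by rewrite -ltr_pdivrMr// div1r /s; lra.
  - by lra.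
  - by rewrite /s in es *; lra.
exists w, a, (E * (2 / (1 - mu))); split.
- by rewrite a4.
- move=> n; rewrite /w ler_wpM2l ?powR_ge0//.
  rewrite -{1}[c n](@powRr1 _ _ (c0 n)) -(@divff _ q) ?gt_eqF// powRrM.
  by apply: ge0_ler_powR; rewrite ?nnegrE ?powR_ge0 ?(ltW qV).
- move=> n k nk; apply: (@le_trans _ _ (w k * (2 `^ (e - s)) ^+ (k - n))); last first.
    by rewrite ler_wpM2l// lerXn2r ?nnegrE ?powR_ge0// (le_trans _ a4).
  rewrite /w P2 (le_trans (ler_wpM2l (powR_ge0 _ _) (hroot n k)))//.
  rewrite le_eqVlt; apply/orP; left; apply/eqP.
  rewrite mulrCA [RHS]mulrAC [RHS]mulrC; congr (_ * _); rewrite -!PD.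
  congr (_ `^ _); rewrite /natdist (eqP nk) add0n natrB//; ring.
- move=> n k kn; apply: (@le_trans _ _ (w k * (2 `^ (s + e - 1)) ^+ (n - k))); last first.
    by rewrite ler_wpM2l// lerXn2r ?nnegrE ?powR_ge0// (le_trans _ a4).
  rewrite /w P2 P2V mulrAC.
  rewrite (le_trans (ler_wpM2l _ (hroot n k))) ?mulr_ge0 ?powR_ge0//.
  rewrite le_eqVlt; apply/orP; left; apply/eqP.
  rewrite mulrCA [RHS]mulrAC [RHS]mulrC; congr (_ * _); rewrite -!PD.
  congr (_ `^ _); rewrite /natdist (eqP kn) addn0 natrB//; ring.
split.
  move=> j m jm; have H : w j <= w m * (2 `^ (e - s)) ^+ (m - j).
    rewrite /w P2 (le_trans (ler_wpM2l (powR_ge0 _ _) (hroot j m)))//.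
    rewrite le_eqVlt; apply/orP; left; apply/eqP.
    rewrite mulrCA [RHS]mulrAC [RHS]mulrC; congr (_ * _); rewrite -!PD.
    congr (_ `^ _); rewrite /natdist (eqP jm) add0n natrB//; ring.
  have {H} := ge0_ler_powR (ltW p0) _ _ H; rewrite !nnegrE w0 => /(_ isT).
  rewrite mulr_ge0 ?exprn_ge0 ?powR_ge0// => /(_ isT).
  rewrite powRM ?exprn_ge0 ?powR_ge0// P2 -powRrM => H.
  apply: (@le_trans _ _ (w m `^ p * 2 ^- m * (2 `^ (1 - (s - e) * p)) ^+ (m - j))).
    rewrite (le_trans (ler_wpM2r _ H)) ?invr_ge0 ?exprn_ge0//.
    rewrite le_eqVlt; apply/orP; left; apply/eqP.
    rewrite -!mulrA; congr (_ * _); rewrite P2 !P2V -!PD.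
    congr (_ `^ _); rewrite natrB//; ring.
  rewrite ler_wpM2l ?mulr_ge0 ?powR_ge0 ?invr_ge0 ?exprn_ge0//.
  by rewrite lerXn2r ?nnegrE ?powR_ge0// (le_trans _ a4).
move=> N; apply: le_trans (hsum N); rewrite le_eqVlt; apply/orP; left; apply/eqP.
apply: eq_bigr => k _; rewrite /w powRM ?powR_ge0// -!powRrM mulVf ?gt_eqF//.
rewrite powRr1// mulrAC -PD.
have -> : k%:R * s * q - k%:R * (1 + q / p) = 0 by rewrite /s; field; rewrite !gt_eqF.
by rewrite powRr0 mul1r.
Qed.

End slow_weights.

(** * Test functions *)

Section complex_series.
Variable R : realType.
Implicit Types (u v : nat -> R[i]) (x : nat -> R).

(* Junk value unless the series of moduli converges. *)
Definition csum u : R[i] :=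
  limn (series (fun n => Re (u n))) +i* limn (series (fun n => Im (u n))).

Lemma abs_bounded_series x (B : R) : (forall N, \sum_(n < N) `|x n| <= B) ->
  cvgn (series x) /\ `|limn (series x)| <= B.
Proof.
move=> xB; have cx := bounded_series_cvg (fun n => normr_ge0 (x n)) xB.
split; first exact: normed_cvg.
apply: (le_trans (lim_series_norm cx)).
exact: lim_series_le_bound (fun n => normr_ge0 (x n)) xB.
Qed.

Lemma csum_Re_Im_bounded u (B : R) : (forall N, \sum_(n < N) normc (u n) <= B) ->
  (forall N, \sum_(n < N) `|Re (u n)| <= B) /\
  (forall N, \sum_(n < N) `|Im (u n)| <= B).
Proof.
move=> uB; split=> N; apply: le_trans (uB N); apply: ler_sum => n _.
  exact: normc_Re_le.
exact: normc_Im_le.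
Qed.

(** The factor 2 comes from bounding real and imaginary parts separately. *)
Lemma normc_csum_le u (B : R) : (forall N, \sum_(n < N) normc (u n) <= B) ->
  normc (csum u) <= 2 * B.
Proof.
move=> /csum_Re_Im_bounded[u1 u2].
have [_ H1] := @abs_bounded_series (fun n => Re (u n)) _ u1; have [_ H2] := @abs_bounded_series (fun n => Im (u n)) _ u2.
by rewrite (le_trans (normc_le_ReIm _))//= mulr_natl mulr2n lerD.
Qed.

Lemma csumDM u v (c : R[i]) (B C : R) :
  (forall N, \sum_(n < N) normc (u n) <= B) ->
  (forall N, \sum_(n < N) normc (v n) <= C) ->
  csum (fun n => u n + c * v n) = csum u + c * csum v.
Proof.
move=> /csum_Re_Im_bounded[u1 u2] /csum_Re_Im_bounded[v1 v2].
have [cu1 _] := @abs_bounded_series (fun n => Re (u n)) _ u1; have [cu2 _] := @abs_bounded_series (fun n => Im (u n)) _ u2.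
have [cv1 _] := @abs_bounded_series (fun n => Re (v n)) _ v1; have [cv2 _] := @abs_bounded_series (fun n => Im (v n)) _ v2.
have cZ (k : R) x : cvgn (series x) -> cvgn (series (fun n => k * x n)) /\
    limn (series (fun n => k * x n)) = k * limn (series x).
  move=> cx; have E : (fun n => k * x n) = k *: (x : nat -> R^o) by [].
  by rewrite E; split; [exact: is_cvg_seriesZ|exact: lim_seriesZ].
have cD (x y : nat -> R) : cvgn (series x) -> cvgn (series y) ->
    cvgn (series (fun n => x n + y n)) /\
    limn (series (fun n => x n + y n)) = limn (series x) + limn (series y).
  move=> cx cy; have E : (fun n => x n + y n) = (x : nat -> R^o) + y by [].
  by rewrite E; split; [exact: is_cvg_seriesD|exact: lim_seriesD].
case: c => a b; rewrite /csum.
have ER : (fun n => Re (u n + (a +i* b) * v n)) =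
    (fun n => Re (u n) + (a * Re (v n) + (- b) * Im (v n))).
  by apply/funext => n; case: (u n) (v n) => ? ? [? ?] /=; rewrite mulNr.
have EI : (fun n => Im (u n + (a +i* b) * v n)) =
    (fun n => Im (u n) + (a * Im (v n) + b * Re (v n))).
  by apply/funext => n; case: (u n) (v n) => ? ? [? ?] /=; rewrite [b * _]mulrC.
rewrite ER EI.
have [a1 a1E] := cZ a _ cv1; have [a2 a2E] := cZ a _ cv2.
have [b1 b1E] := cZ b _ cv1; have [b2 b2E] := cZ (- b) _ cv2.
have [d1 d1E] := cD _ _ a1 b2; have [d2 d2E] := cD _ _ a2 b1.
have [_ ->] := cD _ _ cu1 d1; have [_ ->] := cD _ _ cu2 d2.
rewrite d1E d2E a1E a2E b1E b2E.
by apply/eqP; rewrite eq_complex/= mulNr [b * _]mulrC !eqxx.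
Qed.

Lemma csum_real x : csum (fun n => (x n)%:C) = (limn (series x))%:C.
Proof.
rewrite /csum/=; congr (_ +i* _); apply/cvg_lim => //.
rewrite (_ : series _ = fun=> 0); first exact: cvg_cst.
by apply/funext => n; rewrite /series/= big1.
Qed.

End complex_series.

Section test_function.
Variable R : realType.
Variables (w : nat -> R) (V : R).
Hypothesis w0 : forall n, 0 <= w n.
Hypothesis wV : forall N, \sum_(n < N) w n * 2 ^- n <= V.

Let rad n : R := 1 - 2 ^- n.

Let inv2n_gt0 n : 0 < 2 ^- n :> R.
Proof. by rewrite invr_gt0 exprn_gt0. Qed.

Let inv2n_le1 n : 2 ^- n <= 1 :> R.
Proof. by rewrite invf_le1 ?exprn_gt0// exprn_ege1// ler1n. Qed.

Definition test_fun (z : R[i]) : R[i] :=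
  csum (fun n => (w n * 2 ^- n)%:C / (1 - (1 - 2 ^- n)%:C * z)).

(** The first bound gives locally uniform convergence, the second handles kernels with poles farther
    from 1 than the scale of [z], the third those with closer poles. *)
Lemma normc_1Bradz_ge n (z : R[i]) : normc z < 1 ->
  [/\ 1 - normc z <= normc (1 - (rad n)%:C * z), 2 ^- n <= normc (1 - (rad n)%:C * z)
    & normc (1 - z) / 2 <= normc (1 - (rad n)%:C * z)].
Proof.
move=> z1.
have r0 : 0 <= rad n by rewrite subr_ge0.
have r1 : rad n <= 1 by rewrite /rad; have := inv2n_gt0 n; lra.
have z0 := normc_ge0 z.
have H : 1 - rad n * normc z <= normc (1 - (rad n)%:C * z).
  have := le_normcD (1 - (rad n)%:C * z) ((rad n)%:C * z).
  by rewrite subrK ComplexField.Normc.normc1 normcM normc_real ger0_norm//; lra.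
have H2 : 2 ^- n <= normc (1 - (rad n)%:C * z).
  have hE : 2 ^- n = 1 - rad n by rewrite /rad; ring.
  have z1' : 0 <= 1 - normc z by rewrite subr_ge0 ltW.
  have := mulr_ge0 r0 z1'; rewrite hE mulrBr mulr1; lra.
split => //; first by apply: le_trans H; nra.
have : normc (1 - z) <= normc (1 - (rad n)%:C * z) + 2 ^- n * normc z.
  have -> : 1 - z = (1 - (rad n)%:C * z) - (2 ^- n)%:C * z.
    by rewrite /rad rmorphB/=; ring.
  rewrite (le_trans (normcB_le _ _))// lerD2l normcM normc_real gtr0_norm//.
have := inv2n_gt0 n; nra.
Qed.

Lemma csum_majorant (u : nat -> R[i]) (C : R) : 0 <= C ->
  (forall n, normc (u n) <= w n * 2 ^- n * C) ->
  forall N, \sum_(n < N) normc (u n) <= V * C.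
Proof.
move=> C0 uC N; apply: (@le_trans _ _ (\sum_(n < N) w n * 2 ^- n * C)).
  by apply: ler_sum => n _; exact: uC.
by rewrite -mulr_suml ler_wpM2r.
Qed.

(** Each kernel is a geometric series in [X n]. The finite geometric identity is summed over n with
    its exact remainder [Ek k], so no double series is rearranged; the remainder is at most a
    constant times [rho ^+ k]. *)
Lemma test_fun_analytic : analytic_on (@unit_disc R) test_fun.
Proof.
move=> z0; rewrite /unit_disc/= => z01.
have d0 : 0 < 1 - normc z0 by rewrite subr_gt0.
pose D n (z : R[i]) := 1 - (rad n)%:C * z.
pose v n := (w n * 2 ^- n)%:C.
have nv n : normc (v n) = w n * 2 ^- n.
  by rewrite normc_real ger0_norm// mulr_ge0// ltW.
pose a k := csum (fun n => v n * (rad n)%:C ^+ k / D n z0 ^+ k.+1).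
exists a, (1 - normc z0); split => //= z zz0.
have z1 : normc z < 1 by exact: unit_disc_ball zz0.
have d1 : 0 < 1 - normc z by rewrite subr_gt0.
have rn n : normc (rad n)%:C <= 1.
  rewrite normc_real ger0_norm ?subr_ge0// /rad.
  by have := inv2n_gt0 n; lra.
have Dgt n (y : R[i]) : normc y < 1 -> 0 < normc (D n y).
  by move=> y1; have [_ H _] := normc_1Bradz_ge n y1; exact: lt_le_trans H.
pose rho := normc (z - z0) / (1 - normc z0).
have rho0 : 0 <= rho by rewrite divr_ge0 ?normc_ge0 ?ltW.
have rho1 : rho < 1 by rewrite ltr_pdivrMr// mul1r.
pose X n := (rad n)%:C * (z - z0) / D n z0.
have nX n : normc (X n) <= rho.
  rewrite /X !normcM normcV ler_pM ?mulr_ge0 ?invr_ge0 ?normc_ge0//.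
    by rewrite ler_piMl ?normc_ge0.
  rewrite lef_pV2 ?posrE ?Dgt//.
  by have [] := normc_1Bradz_ge n z01.
pose Ek k := csum (fun n => v n * X n ^+ k / D n z).
have bE k N : \sum_(n < N) normc (v n * X n ^+ k / D n z) <=
    V * (rho ^+ k / (1 - normc z)).
  apply: (@csum_majorant (fun n => v n * X n ^+ k / D n z)) => [|n];
    first by rewrite divr_ge0 ?exprn_ge0// ltW.
  rewrite !normcM nv normcX normcV -mulrA ler_wpM2l ?mulr_ge0 ?(ltW (inv2n_gt0 _))//.
  rewrite ler_pM ?exprn_ge0 ?invr_ge0 ?normc_ge0//.
    by rewrite lerXn2r ?nnegrE ?normc_ge0.
  rewrite lef_pV2 ?posrE ?Dgt//.
  by have [] := normc_1Bradz_ge n z1.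
have ba k N : \sum_(n < N) normc (v n * (rad n)%:C ^+ k / D n z0 ^+ k.+1) <=
    V * (1 - normc z0) ^- k.+1.
  apply: (@csum_majorant (fun n => v n * (rad n)%:C ^+ k / D n z0 ^+ k.+1)) => [|n];
    first by rewrite invr_ge0 exprn_ge0 ?ltW.
  rewrite !normcM nv normcV !normcX -mulrA ler_wpM2l ?mulr_ge0 ?(ltW (inv2n_gt0 _))//.
  have Dk : 0 < normc (D n z0) ^+ k.+1 by rewrite exprn_gt0 ?Dgt.
  apply: (@le_trans _ _ (normc (D n z0) ^- k.+1)).
    by rewrite ler_piMl ?invr_ge0 ?(ltW Dk)// exprn_ile1 ?normc_ge0.
  rewrite lef_pV2 ?posrE ?exprn_gt0 ?Dgt// lerXn2r ?nnegrE ?normc_ge0 ?(ltW d0)//.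
  by have [] := normc_1Bradz_ge n z01.
have step k : Ek k = Ek k.+1 + (z - z0) ^+ k * a k.
  rewrite /Ek /a -(csumDM _ (bE k.+1) (ba k)); congr csum; apply/funext => n.
  have Dz0 : D n z0 != 0 by rewrite -normc_gt0 Dgt.
  have Dz : D n z != 0 by rewrite -normc_gt0 Dgt.
  have EX : X n = 1 - D n z / D n z0.
    by rewrite -[1](divff Dz0) -mulrBl /X /D; congr (_ / _); ring.
  have -> : (z - z0) ^+ k * (v n * (rad n)%:C ^+ k / D n z0 ^+ k.+1) =
      v n * X n ^+ k / D n z0.
    rewrite /X !exprMn exprVn exprS; move: (v n) => vn; field.
    by rewrite Dz0 expf_neq0.
  rewrite exprS {2}EX; move: (v n) (X n) => vn Xn; field.
  by rewrite Dz0 Dz.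
have fE k : test_fun z = Ek k + series (fun k => a k * (z - z0) ^+ k) k.
  elim: k => [|k ih].
    rewrite /series/= big_geq// addr0 /Ek /test_fun; congr csum.
    by apply/funext => n; rewrite expr0 mulr1.
  by rewrite ih step seriesS [(z - z0) ^+ k * _]mulrC addrA.
have V0 : 0 <= V by have := wV 0%N; rewrite big_ord0.
apply/cvg_normcP => e e0.
have e1 : 0 < e * (1 - normc z) / (2 * V + 1) by rewrite divr_gt0 ?mulr_gt0//; lra.
have /cvgrPdist_lt/(_ _ e1)[N _ HN] : (fun n => rho ^+ n) @ \oo --> 0.
  by apply: cvg_expr; rewrite ger0_norm.
exists N => n Nn; have /= := HN n Nn; rewrite sub0r normrN ger0_norm ?exprn_ge0//.
rewrite ltr_pdivlMr; last by lra.
move=> H; rewrite (fE n) addrK (le_lt_trans (normc_csum_le (bE n)))//.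
rewrite !mulrA ltr_pdivrMr//.
have := exprn_ge0 n rho0; nra.
Qed.

(** At a real point of [0, 1) all terms are nonnegative, and the n-th has denominator at most 2 *
    2^-n. *)
Lemma test_fun_dyadic_ge n t : dyadic_interval n t ->
  w n / 2 <= normc (test_fun t%:C).
Proof.
move=> /dyadic_intervalE/andP[t1 t2].
have t01 : 0 <= t < 1.
  by have := inv2n_gt0 n.+1; have := inv2n_le1 n => A B; apply/andP; split; lra.
have /andP[t0 tlt1] := t01.
pose x k := w k * 2 ^- k / (1 - rad k * t).
have Dp k : 1 - t <= 1 - rad k * t.
  by have := inv2n_gt0 k; rewrite /rad; nra.
have Dp0 k : 0 < 1 - rad k * t by apply: lt_le_trans (Dp k); rewrite subr_gt0.
have x0 k : 0 <= x k by rewrite divr_ge0 ?mulr_ge0 ?(ltW (Dp0 _)) ?(ltW (inv2n_gt0 _)).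
have xB N : \sum_(k < N) x k <= V * (1 - t)^-1.
  apply: (@le_trans _ _ (\sum_(k < N) w k * 2 ^- k * (1 - t)^-1)).
    apply: ler_sum => k _; rewrite ler_wpM2l ?mulr_ge0 ?(ltW (inv2n_gt0 _))//.
    by rewrite lef_pV2 ?Dp// posrE ?Dp0// subr_gt0.
  by rewrite -mulr_suml ler_wpM2r// invr_ge0 subr_ge0 ltW.
have -> : test_fun t%:C = (limn (series x))%:C.
  rewrite -csum_real; congr csum; apply/funext => k.
  by rewrite /x [RHS]rmorphM fmorphV [X in _ = _ / X]rmorphB rmorph1 [X in _ = _ / (1 - X)]rmorphM.
rewrite normc_real ger0_norm; last exact: le_trans (x0 0%N) (term_le_lim _ x0 xB).
apply: le_trans (term_le_lim n x0 xB).
rewrite /x -mulrA ler_wpM2l// ler_pdivlMr// ler_pdivrMl//.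
by move: (inv2n_gt0 n) t2; rewrite /rad; move: (2 ^- n) => h h0 t2; nra.
Qed.

(** For n <= k the denominator is at least 2^-n, for n >= k at least |1 - z|/2 >= 2^-k/8. Thus 32 =
    2 * 8 * 2, from [csum], the denominators and the two-sided geometric sum. *)
Lemma normc_test_fun_le (a : R) k (z : R[i]) : 2^-1 <= a < 1 ->
  (forall n, (n <= k)%N -> w n <= w k * a ^+ (k - n)) ->
  (forall n, (k <= n)%N -> w n * 2 ^- (n - k) <= w k * a ^+ (n - k)) ->
  normc z < 1 -> 2 ^- k <= 4 * normc (1 - z) ->
  normc (test_fun z) <= 32 / (1 - a) * w k.
Proof.
move=> /andP[a2 a1] wl wr z1 kz.
have a0 : 0 < a by rewrite (lt_le_trans _ a2)// invr_gt0.
have d0 : 0 < 1 - a by rewrite subr_gt0.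
have -> : 32 / (1 - a) * w k = 2 * (8 * w k * (2 / (1 - a))) by ring.
apply: normc_csum_le => N.
apply: (@le_trans _ _ (\sum_(n < N) 8 * w k * a ^+ natdist n k)).
  apply: ler_sum => n _; rewrite normcM normcV normc_real -/(rad n).
  rewrite ger0_norm ?mulr_ge0 ?(ltW (inv2n_gt0 _))//.
  have [_ H1 H2] := normc_1Bradz_ge n z1.
  have D0 : 0 < normc (1 - (rad n)%:C * z) by exact: lt_le_trans H1.
  rewrite ler_pdivrMr//.
  have [nk|/ltnW kn] := leqP n k.
    have -> : natdist n k = (k - n)%N by rewrite /natdist (eqP nk).
    have := wl n nk; have := w0 n.
    move: (w k * a ^+ (k - n)) (mulrA 8 (w k) (a ^+ (k - n))) => W <- wn0 wW.
    apply: (@le_trans _ _ (W * 2 ^- n)); first by rewrite ler_wpM2r// ltW.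
    have W0 : 0 <= W by exact: le_trans wW.
    have := ler_wpM2l W0 H1; have := mulr_ge0 W0 (ltW D0); lra.
  have -> : natdist n k = (n - k)%N by rewrite /natdist (eqP kn) addn0.
  have := wr n kn; have := w0 n.
  have -> : 2 ^- n = 2 ^- (n - k) * 2 ^- k :> R by rewrite -invfM -exprD subnK.
  move: (w k * a ^+ (n - k)) (mulrA 8 (w k) (a ^+ (n - k))) => W <- wn0 wW.
  rewrite mulrA; apply: (@le_trans _ _ (W * 2 ^- k)).
    by rewrite ler_wpM2r// ltW.
  have W0 : 0 <= W.
    by apply: le_trans wW; rewrite mulr_ge0// invr_ge0 exprn_ge0.
  have H3 : 2 ^- k <= 8 * normc (1 - (rad n)%:C * z) by lra.
  have := ler_wpM2l W0 H3; lra.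
rewrite -mulr_sumr ler_wpM2l ?mulr_ge0//.
have := @sum_expr_natdist_le R a N k; rewrite a0 a1 => /(_ isT)/le_trans; apply.
by rewrite ler_wpM2r ?invr_ge0 ?(ltW d0)// gerBl exprn_ge0// ltW.
Qed.

End test_function.

Section nneseries_bounds.
Variable R : realType.

Lemma nneseries_le_bound (x : nat -> R) (B : R) :
  (forall n, 0 <= x n) -> (forall N, \sum_(n < N) x n <= B) ->
  (\sum_(0 <= n <oo) (x n)%:E <= B%:E)%E.
Proof.
move=> x0 xB; apply: lime_le; first by apply: is_cvg_nneseries => n _ _; rewrite lee_fin.
by apply: nearW => N; rewrite sumEFin lee_fin big_mkord.
Qed.

Lemma nneseries_lt_bounded (x : nat -> R) : (forall n, 0 <= x n) ->
  (\sum_(0 <= n <oo) (x n)%:E < +oo)%E ->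
  exists B, forall N, \sum_(n < N) x n <= B.
Proof.
move=> x0 xoo; have s0 : (0 <= \sum_(0 <= n <oo) (x n)%:E)%E.
  by apply: nneseries_ge0 => n _ _; rewrite lee_fin.
exists (fine (\sum_(0 <= n <oo) (x n)%:E)%E) => N.
rewrite -lee_fin fineK ?ge0_fin_numE// -sumEFin -(big_mkord xpredT (fun n => (x n)%:E)).
by apply: nneseries_lim_ge => n _ _; rewrite lee_fin.
Qed.

End nneseries_bounds.

(** * Upper bounds for integrals over the circle and over cones *)

Section circle.
Variable R : realType.
Local Notation leb := (@lebesgue_measure R).

(** With y = x/2, sin x = 2 sin y cos y and sin y = y cos c for some c below y; both cosines are at
    least cos (pi/4), whose square is 1/2. *)
Lemma sin_ge_half (x : R) : 0 <= x <= pi / 2 -> x / 2 <= sin x.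
Proof.
move=> /andP[x0 xpi].
have cpi4 : 2^-1 <= cos (pi / 4 : R) ^+ 2.
  have := @cos_mulr2n R (pi / 4).
  have -> : (pi / 4 : R) *+ 2 = pi / 2 by rewrite -mulr_natr; field.
  by rewrite cos_pihalf => H; lra.
have [<-|xn0] := eqVneq 0 x; first by rewrite mul0r sin0.
have {xn0}x0 : 0 < x by rewrite lt_neqAle xn0.
have pi0 := @pi_gt0 R.
pose y := x / 2.
have y0 : 0 < y by rewrite divr_gt0.
have ypi : y <= pi / 4 by rewrite /y; lra.
have cge (t : R) : 0 <= t <= pi / 4 -> cos (pi / 4) <= cos t.
  move=> /andP[t0 tpi]; rewrite leNgt; apply/negP.
  rewrite ltr_cos ?in_itv/=; last 2 first.
  - by apply/andP; split; lra.
  - by apply/andP; split; lra.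
  lra.
have c40 : 0 <= cos (pi / 4 : R).
  by apply: cos_ge0_pihalf; apply/andP; split; lra.
have [c] := @MVT R sin cos 0 y y0 (fun z _ => is_derive_sin z)
  (continuous_subspaceT (@continuous_sin R)).
rewrite in_itv/= sin0 !subr0 => /andP[c0 cy] sy.
have -> : x = y *+ 2 by rewrite /y -mulr_natr; field.
rewrite sin_mulr2n sy.
have H1 : cos (pi / 4) <= cos c by apply: cge; apply/andP; split; lra.
have H2 : cos (pi / 4) <= cos y by apply: cge; apply/andP; split; lra.
have H3 : 2^-1 <= cos y * cos c.
  by rewrite (le_trans cpi4)// expr2 ler_pM.
have := ler_wpM2r (ltW y0) H3; rewrite -mulr_natr; lra.
Qed.

Lemma circle_dist_ge (t : R) : 0 <= t <= 2 * pi ->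
  t <= 2 * normc (1 - (cos t +i* sin t)) \/
  2 * pi - t <= 2 * normc (1 - (cos t +i* sin t)).
Proof.
move=> /andP[t0 t2]; rewrite circle_dist.
have [tpi|pit] := leP t pi.
  left; have := @sin_ge_half (t / 2); have := ler_norm (sin (t / 2)).
  move=> A /(_ _); move: A; case: (boolP (0 <= t / 2 <= pi / 2)) => [_ A /(_ isT)|].
    lra.
  by move/negP => H; exfalso; apply: H; apply/andP; split; lra.
right; have := @sin_ge_half (pi - t / 2); have := ler_norm (sin (t / 2)).
have -> : sin (pi - t / 2) = sin (t / 2) by rewrite sinB sinpi cospi; ring.
move=> A /(_ _); move: A; case: (boolP (0 <= pi - t / 2 <= pi / 2)) => [_ A /(_ isT)|].
  lra.
by move/negP => H; exfalso; apply: H; apply/andP; split; lra.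
Qed.

Lemma circle_integral_le (Psi : R[i] -> \bar R) (H : nat -> R) :
  (forall n, 0 <= H n) ->
  (forall xi : R[i], normc xi = 1 -> (0 <= Psi xi)%E) ->
  (forall m (xi : R[i]), normc xi = 1 -> 2 ^- m < normc (1 - xi) <= 2 * 2 ^- m ->
    (Psi xi <= (H m)%:E)%E) ->
  (circle_integral Psi <= \sum_(0 <= n <oo) (8 * (H n * 2 ^- n))%:E)%E.
Proof.
move=> H0 Psi0 PsiH.
pose I m : set R := `[0, 4 * 2 ^- m] `|` `[2 * pi - 4 * 2 ^- m, 2 * pi].
(* Index 0 is reserved for the point 1 of the circle, where no bound is assumed: there the value is
   [+oo] on a null set, and the product is 0. The dyadic arcs are shifted by one. *)
pose A n := if n is m.+1 then I m else [set 0; 2 * pi].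
pose v n := if n is m.+1 then (H m)%:E else (+oo)%E.
have mA n : measurable (A n).
  by case: n => [|n]; apply: measurableU.
have v0 n : (0 <= v n)%E by case: n => [|n] //=; rewrite lee_fin.
apply: (@le_trans _ _ (\sum_(n <oo) v n * leb (A n))%E).
  apply: integral_le_series => //.
    by move=> t _; apply: Psi0; exact: normc_circle.
  move=> t; rewrite /= in_itv/= => t02.
  have [d0|dn0] := eqVneq (normc (1 - (cos t +i* sin t))) 0.
    exists 0%N; last exact: leey.
    move: (t02) => /andP[t0 t2].
    by case: (circle_dist_ge t02); rewrite d0 => ?; [left|right]; rewrite /=; lra.
  have d0 : 0 < normc (1 - (cos t +i* sin t)) / 2.
    by rewrite divr_gt0// lt_neqAle eq_sym dn0 normc_ge0.
  have d1 : normc (1 - (cos t +i* sin t)) / 2 <= 1.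
    have := normcB_le 1 (cos t +i* sin t).
    by rewrite ComplexField.Normc.normc1 normc_circle; lra.
  have [|m] := @dyadic_scale R (normc (1 - (cos t +i* sin t)) / 2).
    by rewrite d0.
  have E : 2 ^- m.+1 = 2 ^- m / 2 :> R by rewrite exprS invfM mulrC.
  rewrite E => /andP[m1 m2]; exists m.+1 => /=.
    move: (t02) => /andP[t0 t2].
    case: (circle_dist_ge t02) => Ht; [left|right]; rewrite /= in_itv/=.
      by rewrite t0/=; lra.
    by rewrite t2 andbT; lra.
  by apply: PsiH; [exact: normc_circle|apply/andP; split; lra].
rewrite nneseries_recl//; last by move=> n _; rewrite mule_ge0.
have l0 : leb (A 0%N) = 0%E.
  apply/eqP; rewrite eq_le measure_ge0 andbT.
  by rewrite (le_trans (measureU2 _ _ _))//= !lebesgue_measure_set1 adde0.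
rewrite l0 mule0 add0e.
rewrite -(nneseries_addn 1); last by move=> n; rewrite mule_ge0.
apply: lee_nneseries => [n _|n _]; rewrite addn1.
  by rewrite mule_ge0.
have E (a b : R) : a <= b -> leb `[a, b]%classic = (b - a)%:E.
  move=> ab; rewrite lebesgue_measure_itv/= lte_fin; case: ifPn => [_|].
    by rewrite EFinB.
  by rewrite -leNgt => ba; congr (_%:E); lra.
have n0 : 0 < 2 ^- n :> R by rewrite invr_gt0 exprn_gt0.
have -> : (8 * (H n * 2 ^- n))%:E = ((H n)%:E * (8 * 2 ^- n)%:E)%E.
  by rewrite -EFinM; congr (_%:E); ring.
rewrite /= lee_wpmul2l ?lee_fin//.
apply: (le_trans (measureU2 _ _ _)) => //=.
rewrite !E; [|lra..].
by rewrite -EFinD lee_fin; lra.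
Qed.

End circle.

Section cone_upper_bound.
Variable R : realType.
Local Notation leb := (@lebesgue_measure R).

(** The cone is cut into layers |z - xi| ~ 2^-j. Farther from [xi] than 2^-m, the size of [f]
    follows the scale 2^-j; closer, it stays at the scale 2^-m of the distance from [xi] to 1. Both
    groups decay geometrically away from j = m. *)
Lemma cone_integral_le (p a C : R) (w : nat -> R) (f : R[i] -> R[i]) m (xi : R[i]) :
  1 < p -> 2^-1 <= a < 1 -> 0 <= C -> (forall n, 0 <= w n) ->
  (forall k z, normc z < 1 -> 2 ^- k <= 4 * normc (1 - z) ->
    normc (f z) <= C * w k) ->
  (forall j, (j <= m)%N -> w j `^ p * 2 ^- j <= w m `^ p * 2 ^- m * a ^+ (m - j)) ->
  normc xi = 1 -> 2 ^- m < normc (1 - xi) ->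
  (cone_integral p f xi <=
    (pi^-1 * (48 * C `^ p * (w m `^ p * 2 ^- m) * (2 / (1 - a))))%:E)%E.
Proof.
move=> p1 /andP[a2 a1] C0 w0 fC wp nxi xim.
have p0 : 0 < p by exact: lt_trans p1.
have a0 : 0 < a by rewrite (lt_le_trans _ a2)// invr_gt0.
have i0 n : 0 < 2 ^- n :> R by rewrite invr_gt0 exprn_gt0.
rewrite /cone_integral /area_integral EFinM.
rewrite lee_wpmul2l ?lee_fin ?invr_ge0 ?pi_ge0//.
(* The j-th layer lies in a square of area 16 * 4^-j about [xi], where the weight is at most 3 *
   2^j; together these give the constant 48 and the factor 2^-j. *)
pose k j := minn j m.
pose v j : R := C `^ p * w (k j) `^ p * (3 * 2 ^+ j).
pose Q j : set (R * R) :=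
  `[Re xi - 2 * 2 ^- j, Re xi + 2 * 2 ^- j] `*` `[Im xi - 2 * 2 ^- j, Im xi + 2 * 2 ^- j].
have v0 j : 0 <= v j by rewrite !mulr_ge0 ?powR_ge0// exprn_ge0.
apply: (@le_trans _ _ (\sum_(j <oo) (v j)%:E * (leb \x leb) (Q j))%E).
  apply: integral_le_series.
  - by move=> j; rewrite lee_fin.
  - by move=> j; apply: measurableX; exact: measurable_itv.
  - by move=> z /(Gamma_halfP nxi)[z1 _]; rewrite lee_fin cone_integrand_ge0.
  move=> [x y] /= /(Gamma_halfP nxi); set z := x +i* y => -[z1 zxi].
  have d1 : normc (z - xi) / 2 <= 1.
    by have := normcB_le z xi; rewrite nxi; lra.
  have d0 : 0 < normc (z - xi) / 2.
    rewrite divr_gt0// lt_neqAle normc_ge0 andbT eq_sym normc_eq0 subr_eq0.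
    by apply/eqP => zE; move: z1; rewrite zE nxi ltxx.
  have [|j] := @dyadic_scale R (normc (z - xi) / 2); first by rewrite d0.
  have E : 2 ^- j.+1 = 2 ^- j / 2 :> R by rewrite exprS invfM mulrC.
  rewrite E => /andP[j1 j2]; exists j.
    have := normc_Re_le (z - xi); have := normc_Im_le (z - xi).
    have -> : Re (z - xi) = x - Re xi by rewrite /z; case: xi {nxi xim Q zxi d1 d0 j1 j2}.
    have -> : Im (z - xi) = y - Im xi by rewrite /z; case: xi {nxi xim Q zxi d1 d0 j1 j2}.
    by move=> H1 H2; split; rewrite /= in_itv/= -ler_distl; lra.
  (* Since 1 - |z| <= |1 - z|, the nontangential bound gives [z2]; the triangle inequality through
     [z] then gives [z3]. They cover the cases j <= m and j >= m respectively. *)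
  have z2 : normc (z - xi) / 3 <= normc (1 - z).
    have := le_normcD (1 - z) z; rewrite subrK ComplexField.Normc.normc1; lra.
  have z3 : normc (1 - xi) / 4 <= normc (1 - z).
    have := le_normcD (1 - z) z; rewrite subrK ComplexField.Normc.normc1.
    have := normc_dist_le z 1 xi; lra.
  have fz : normc (f z) <= C * w (k j).
    apply: fC => //; rewrite /k; case: (leqP j m) => [jm|/ltnW mj].
      have := i0 j; lra.
    lra.
  rewrite lee_fin /v -powRM// ler_pM ?powR_ge0//.
  - by rewrite invr_ge0 subr_ge0 exprn_ile1 ?normc_ge0// ltW.
  - by rewrite ge0_ler_powR ?nnegrE ?normc_ge0 ?mulr_ge0// ltW.
  have z0 := normc_ge0 z.
  have D0 : 0 < 1 - normc z ^+ 2 by nra.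
  have D1 : 2 ^- j <= 3 * (1 - normc z ^+ 2) by nra.
  rewrite -[leLHS]mul1r ler_pdivrMr// -mulrA mulrCA -ler_pdivrMl ?exprn_gt0//.
  by rewrite mulr1.
have E j : ((v j)%:E * (leb \x leb) (Q j) =
    (48 * C `^ p * (w (k j) `^ p * 2 ^- j))%:E)%E.
  rewrite lebesgue_square ?mulr_ge0 ?(ltW (i0 _))// -EFinM; congr (_%:E).
  by rewrite /v; field; rewrite expf_neq0.
rewrite (eq_eseriesr (fun j _ => E j)); apply: nneseries_le_bound => [j|N].
  by rewrite !mulr_ge0 ?powR_ge0// ltW.
apply: (@le_trans _ _ (\sum_(j < N) 48 * C `^ p * (w m `^ p * 2 ^- m) * a ^+ natdist j m)).
  apply: ler_sum => j _; rewrite -[leRHS]mulrA ler_wpM2l ?mulr_ge0 ?powR_ge0//.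
  rewrite /k; case: (leqP j m) => [jm|/ltnW mj].
    by rewrite /natdist (eqP jm) add0n wp.
  rewrite /natdist (eqP mj) addn0.
  have -> : 2 ^- j = 2 ^- m * 2 ^- (j - m) :> R by rewrite -invfM -exprD subnKC.
  rewrite mulrA ler_wpM2l ?mulr_ge0 ?powR_ge0 ?(ltW (i0 _))//.
  by rewrite -exprVn lerXn2r ?nnegrE ?(ltW a0)// invr_ge0.
rewrite -mulr_sumr ler_wpM2l ?mulr_ge0 ?powR_ge0 ?(ltW (i0 _))//.
have := @sum_expr_natdist_le R a N m; rewrite a0 a1 => /(_ isT)/le_trans; apply.
by rewrite ler_wpM2r ?invr_ge0 ?subr_ge0 ?(ltW a1)// gerBl exprn_ge0// ltW.
Qed.

End cone_upper_bound.

(** * Necessity of the dyadic condition *)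

Section necessity.
Variable R : realType.

Lemma dyadic_growth_attained (p q : R) (c : nat -> R) (E : R) :
  1 < p -> 1 < q -> p^-1 + q^-1 < 1 -> (forall n, 0 <= c n) ->
  (forall N, \sum_(n < N) c n `^ q <= E) ->
  exists2 f, AT_space p q f & forall n t, dyadic_interval n t ->
    2 `^ (n%:R * (p^-1 + q^-1)) * c n / 2 <= normc (f t%:C).
Proof.
move=> p1 q1 s1 c0 cE.
have p0 : 0 < p by exact: lt_trans p1.
have q0 : 0 < q by exact: lt_trans q1.
have [w [a [E' [a12 cw wl wr [wp wq]]]]] := slow_weights p1 q1 s1 c0 cE.
have /andP[a2 a1] := a12.
have a0 : 0 < a by rewrite (lt_le_trans _ a2)// invr_gt0.
have w0 n : 0 <= w n by apply: le_trans (cw n); rewrite mulr_ge0// powR_ge0.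
(* The decay condition at k = 0 is the summability that makes the test function converge on the
   disc. *)
have wV N : \sum_(n < N) w n * 2 ^- n <= w 0%N * (2 / (1 - a)).
  apply: (@le_trans _ _ (\sum_(n < N) w 0%N * a ^+ natdist n 0)).
    by apply: ler_sum => n _; have := wr n 0%N (leq0n _); rewrite /natdist subn0 sub0n addn0.
  rewrite -mulr_sumr ler_wpM2l//.
  have := @sum_expr_natdist_le R a N 0; rewrite a0 a1 => /(_ isT)/le_trans; apply.
  by rewrite ler_wpM2r ?invr_ge0 ?subr_ge0 ?(ltW a1)// gerBl exprn_ge0// ltW.
exists (test_fun w); last first.
  move=> n t nt; apply: le_trans (test_fun_dyadic_ge w0 wV nt).
  by rewrite ler_wpM2r ?invr_ge0.
split; first exact: test_fun_analytic w0 wV.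
rewrite /AT_norm; apply: poweR_lty.
pose C := 32 / (1 - a).
have C0 : 0 <= C by rewrite divr_ge0// subr_ge0 ltW.
have [M M0 ME] : exists2 M : R, 0 <= M & M = pi^-1 * (48 * C `^ p * (2 / (1 - a))).
  eexists; last by [].
  by rewrite !mulr_ge0 ?invr_ge0 ?pi_ge0 ?powR_ge0// subr_ge0 ltW.
have i0 n : 0 < 2 ^- n :> R by rewrite invr_gt0 exprn_gt0.
pose H m := (M * (w m `^ p * 2 ^- m)) `^ (q / p).
have H0 m : 0 <= H m by exact: powR_ge0.
apply: (@le_lt_trans _ _ (\sum_(0 <= n <oo) (8 * (H n * 2 ^- n))%:E)%E).
  apply: circle_integral_le => [//|xi _|m xi nxi /andP[xim _]].
    exact: poweR_ge0.
  rewrite -[area_integral _ _]/(cone_integral p (test_fun w) xi) /H -poweR_EFin.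
  have := @cone_integral_le R p a C w (test_fun w) m xi p1 a12 C0 w0 _ _ nxi xim.
  move=> CH; apply: gt0_ler_poweR.
  - by rewrite divr_ge0 ?ltW.
  - by rewrite in_itv/= leey andbT cone_integral_ge0.
  - by rewrite in_itv/= leey andbT lee_fin mulr_ge0// mulr_ge0 ?powR_ge0 ?(ltW (i0 _)).
  have -> : M * (w m `^ p * 2 ^- m) =
      pi^-1 * (48 * C `^ p * (w m `^ p * 2 ^- m) * (2 / (1 - a))) by rewrite ME; ring.
  apply: CH => [k z z1 kz|j jm]; last exact: wp.
  apply: (normc_test_fun_le w0 a12) => //.
    by move=> n; exact: wl.
  by move=> n; exact: wr.
(* The exponent 1 + q/p combines one factor 2^-n for the length of the arc with 2^(-n q/p) from the
   cone integral; it equals s q, so the sum is that of the smoothed c^q. *)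
have E0 n : 8 * (H n * 2 ^- n) =
    8 * M `^ (q / p) * (w n `^ q * 2 `^ (- (n%:R * (1 + q / p)))).
  have qp : p * (q / p) = q by field; rewrite gt_eqF.
  rewrite /H powRM ?mulr_ge0 ?powR_ge0 ?(ltW (i0 _))//.
  rewrite powRM ?powR_ge0 ?(ltW (i0 _))// -powRrM qp.
  rewrite -!mulrA; congr (_ * (_ * (_ * _))).
  rewrite -powR_invn// -powRrM -powRD ?pnatr_eq0 ?implybT//.
  by congr (_ `^ _); ring.
apply: (@le_lt_trans _ _ (8 * M `^ (q / p) * E')%:E); last exact: ltry.
apply: nneseries_le_bound => [n|N]; first by rewrite !mulr_ge0// ltW.
under eq_bigr do rewrite E0.
by rewrite -mulr_sumr ler_wpM2l ?mulr_ge0 ?powR_ge0.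
Qed.

Lemma dyadic_sum_of_I_well_defined (p q q' : R)
    (mu : {finite_measure set (measurableTypeR R) -> \bar R}) :
  1 < p -> 1 < q -> p^-1 + q^-1 < 1 -> q^-1 + q'^-1 = 1 ->
  I_well_defined p q mu ->
  (\sum_(0 <= n <oo)
     (mu (@dyadic_interval R n) *
      (2 `^ (n%:R * (p^-1 + q^-1)))%:E) `^ q' < +oo)%E.
Proof.
move=> p1 q1 s1 qq' wd.
pose m n := fine (mu (@dyadic_interval R n)).
have mE n : mu (@dyadic_interval R n) = (m n)%:E.
  by rewrite fineK// fin_num_measure//; exact: measurable_itv.
have m0 n : 0 <= m n by rewrite fine_ge0.
pose s n : R := 2 `^ (n%:R * (p^-1 + q^-1)).
have s0 n : 0 <= s n by exact: powR_ge0.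
have E n : ((mu (@dyadic_interval R n) * (s n)%:E) `^ q' = ((m n * s n) `^ q')%:E)%E.
  by rewrite mE -EFinM poweR_EFin.
rewrite (eq_eseriesr (fun n _ => E n)).
have b0 n : 0 <= m n * s n by rewrite mulr_ge0.
have [|B HB] := @landau_bounded R q q' (fun n => m n * s n) q1 qq' b0; last first.
  apply: (@le_lt_trans _ _ B%:E); last exact: ltry.
  by apply: nneseries_le_bound => // n; exact: powR_ge0.
move=> c c0 [B cB].
have [f ATf Hf] := dyadic_growth_attained p1 q1 s1 c0 cB.
(* At z = 0 the kernel is 1, so the hypothesis is plain integrability of [f], and the lower bounds
   on the disjoint dyadic intervals may be summed. *)
have := wd f ATf 0; rewrite /unit_disc/= ComplexField.Normc.normc0 => /(_ ltr01) foo.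
have soo : (\sum_(n <oo) (s n * c n / 2)%:E * mu (@dyadic_interval R n) < +oo)%E.
  apply: le_lt_trans foo; apply: series_le_integral.
  - by move=> n; rewrite lee_fin divr_ge0// mulr_ge0.
  - by move=> n; exact: measurable_itv.
  - move=> n t /dyadic_intervalE/andP[t1 t2]; rewrite /= in_itv/=.
    have : 2 ^- n <= 1 :> R by rewrite invf_le1 ?exprn_gt0// exprn_ege1// ler1n.
    have : 0 < 2 ^- n.+1 :> R by rewrite invr_gt0 exprn_gt0.
    by move=> ? ?; apply/andP; split; lra.
  - apply: ltn_trivIset => n2 n1 n12; rewrite -subset0 => t [].
    move=> /dyadic_intervalE/andP[t1 t2] /dyadic_intervalE/andP[t3 t4].
    have : 1 - t <= 2 ^- n1.+1.
      by rewrite (le_trans t4)// lef_pV2 ?posrE ?exprn_gt0// ler_eXn2l ?ltr1n.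
    by rewrite leNgt t1.
  - by move=> t _; rewrite lee_fin divr_ge0 ?normc_ge0.
  move=> n t nt; rewrite lee_fin mulr0 subr0 ComplexField.Normc.normc1 divr1.
  exact: Hf.
have E2 n : ((s n * c n / 2)%:E * mu (@dyadic_interval R n) =
    (2^-1 * (c n * (m n * s n)))%:E)%E.
  by rewrite mE -EFinM; congr (_%:E); ring.
rewrite (eq_eseriesr (fun n _ => E2 n)) in soo.
have [|D HD] := nneseries_lt_bounded _ soo.
  by move=> n; rewrite !mulr_ge0// invr_ge0.
exists (2 * D) => N; have := HD N; rewrite -mulr_sumr.
by rewrite mulrC ler_pdivrMr// mulrC.
Qed.

End necessity.

Close Scope complex_scope.
Unset Implicit Arguments.

Theorem proposition1p4 (R : realType) (p q q' : R)
    (mu : {finite_measure set (measurableTypeR R) -> \bar R}) :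
  1 < p -> 1 < q -> p^-1 + q^-1 < 1 -> q^-1 + q'^-1 = 1 ->
  mu (~` `[0 : R, 1[) = 0%E ->
  I_well_defined p q mu <->
  (\sum_(0 <= n <oo)
     (mu (@dyadic_interval R n) *
      (2 `^ (n%:R * (p^-1 + q^-1)))%:E) `^ q' < +oo)%E.
Proof.
move=> p1 q1 s1 qq' _; split; first exact: dyadic_sum_of_I_well_defined.
exact: I_well_defined_of_dyadic_sum.
Qed.
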